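(* Let $\Lambda\ge 1$ and let $\mathcal{H}_\Lambda$ be the real vector space of $\Lambda\times\Lambda$ Hermitian matrices $\phi=(\phi_{ab})_{a,b=1}^{\Lambda}$, equipped with its Lebesgue measure $d\phi$. Let $S:\mathcal{H}_\Lambda\to\mathbb{R}$ be a finite sum of traces, $S[\phi]=\sum_k g_k\,\mathrm{Tr}(\phi^k)$. For a scale parameter $N$, let $R=([r_N]_{ab;cd})_{a,b,c,d=1}^{\Lambda}$ be complex coefficients satisfying $[r_N]_{ab;cd}=[r_N]_{cd;ab}$ for all $a,b,c,d$, and set $\Delta S_N[\phi]=\frac12\sum_{a,b,c,d}\phi_{ab}[r_N]_{ab;cd}\phi_{cd}$. For a complex $\Lambda\times\Lambda$ matrix $J$ write $J\cdot\phi=\sum_{a,b}J_{ab}\phi_{ab}$ and define $$\mathcal{Z}_N[J]=e^{\mathcal{W}_N[J]}=\int_{\mathcal{H}_\Lambda}d\phi\;e^{-S[\phi]-\Delta S_N[\phi]+J\cdot\phi},$$ where the entries $J_{ab}$ are treated as independent complex variables. Assume that for every $J$ this integral, as well as the integrals obtained by inserting any polynomial in the entries of $\phi$ into the integrand, converge absolutely (so that derivatives $\partial/\partial J_{ab}$ may be taken under the integral sign). Then for every fixed pair of indices $a,c\in\{1,\dots,\Lambda\}$, $$\sum_{b,d,e}\frac{\partial}{\partial J_{de}}\Big([r_N]_{ab;de}\frac{\partial}{\partial J_{cb}}-[r_N]_{bc;de}\frac{\partial}{\partial J_{ba}}\Big)e^{\mathcal{W}_N[J]}-\sum_b\Big(J_{ab}\frac{\partial}{\partial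 J_{cb}}-J_{bc}\frac{\partial}{\partial J_{ba}}\Big)e^{\mathcal{W}_N[J]}=0 .$$
   Context: $\mathcal{Z}_N$ is the regularized partition function of a Hermitian matrix model with a (generally non-unitarily-invariant) quadratic regulator term $\Delta S_N$; $\mathcal{W}_N=\ln\mathcal{Z}_N$. In the identity there is summation over $b,d,e$ but not over $a$ and $c$. *)

(* Defs.v *)
From HB Require Import structures.
From mathcomp Require Import all_boot all_order all_algebra.
From mathcomp Require Import all_classical all_reals all_analysis.
From mathcomp Require Import complex.
Set Implicit Arguments. Unset Strict Implicit. Unset Printing Implicit Defensive.
Import Order.TTheory GRing.Theory Num.Theory.
Import numFieldNormedType.Exports.
Local Open Scope ring_scope.
Local Open Scope complex_scope.

(** Canonical topology / normed-module structure on R[i] (the same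
    generic construction as numFieldTopology / numFieldNormedType, which are
    keyed on variables and therefore do not fire on the head complex). *)
#[non_forgetful_inheritance]
HB.instance Definition _ (R : rcfType) := PseudoPointedMetric.copy R[i] R[i]^o.
#[non_forgetful_inheritance]
HB.instance Definition _ (R : rcfType) := GRing.ComAlgebra.copy R[i] R[i]^o.
#[non_forgetful_inheritance]
HB.instance Definition _ (R : rcfType) := Vector.copy R[i] R[i]^o.
#[non_forgetful_inheritance]
HB.instance Definition _ (R : rcfType) := NormedModule.copy R[i] R[i]^o.

Section Defs.
Variable R : realType.
Local Notation C := R[i].

Definition cexp (z : C) : C :=
  (expR (complex.Re z) * cos (complex.Im z)) +i* (expR (complex.Re z) * sin (complex.Im z)).

Definition cint (f : R -> C) : C :=
  (Rintegral lebesgue_measure setT (fun t => complex.Re (f t)))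
  +i* (Rintegral lebesgue_measure setT (fun t => complex.Im (f t))).

Definition upd (K : eqType) (x : K -> R) (k : K) (t : R) : K -> R :=
  fun k' => if k' == k then t else x k'.

Fixpoint iterint (K : eqType) (s : seq K) (f : (K -> R) -> C) (x : K -> R) : C :=
  match s with
  | [::] => f x
  | k :: s' => cint (fun t => iterint s' f (upd x k t))
  end.

Fixpoint iterint_abs (K : eqType) (s : seq K) (f : (K -> R) -> R) (x : K -> R)
  : \bar R :=
  match s with
  | [::] => (f x)%:E
  | k :: s' => (\int[lebesgue_measure]_t iterint_abs s' f (upd x k t))%E
  end.

Variable L : nat.

(** real coordinates of the space of L x L Hermitian matrices:
    phi_aa = x(a,a), and for a < b : phi_ab = x(a,b) + i x(b,a),
    phi_ba = conj phi_ab. *)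
Definition herm (x : 'I_L * 'I_L -> R) : 'M[C]_L :=
  \matrix_(a, b)
    if a == b then x (a, a) +i* 0
    else if (a < b)%N then x (a, b) +i* x (b, a)
    else x (b, a) -i* x (a, b).

(** Lebesgue integral over H_L (d phi = prod_a d phi_aa prod_{a<b} dRe phi_ab
    dIm phi_ab), computed as iterated integral over the L^2 real coordinates *)
Definition herm_int (F : 'M[C]_L -> C) : C :=
  iterint (enum {: 'I_L * 'I_L}) (fun x => F (herm x)) (fun _ => 0).

Definition herm_abs_integrable (F : 'M[C]_L -> C) : Prop :=
  (iterint_abs (enum {: 'I_L * 'I_L})
     (fun x => Normc.normc (F (herm x))) (fun _ => 0%R) < +oo)%E.
End Defs.

(* Main.v *)
(* Both terms of the identity are integrals of polynomials in phi against the
   weight F_J = exp (- S - Delta S + J . phi): since |exp z - 1 - z| is at most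
   16 |z|^2 exp |Re z|, and exp (|Re w| + |Im w|) is bounded by the sum of the
   four |exp ((+-1 +- i) w)|, the difference quotients in direction E_ij are
   dominated by integrands with shifted sources J + (+-1 +- i) E_ij, so that
   d/dJ_ij inserts phi_ij.
   The identity is then the vanishing of the integral of the divergence of
   F_J X, where X(phi) = [E_ac, phi] = sum_b (phi_cb E_ab - phi_ba E_bc): the
   vector field X is divergence free and annihilates S by cyclicity of the
   trace, so only - Delta S + J . phi is differentiated.  Integrals of partial
   derivatives in the real coordinates vanish by Fubini and the fundamental
   theorem of calculus, and derivatives in the directions E_ij are complex
   linear combinations of those. *)
Require Import Defs.
From HB Require Import structures.
From mathcomp Require Import all_boot all_order all_algebra.
From mathcomp Require Import all_classical all_reals all_analysis.
From mathcomp Require Import complex measurable_realfun ring lra.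
Import Order.TTheory GRing.Theory Num.Theory.
Import numFieldNormedType.Exports.
Set Implicit Arguments. Unset Strict Implicit. Unset Printing Implicit Defensive.
Local Open Scope classical_set_scope.
Local Open Scope ring_scope.
Local Open Scope complex_scope.

(** The integral over Hermitian matrices is a nest of one-dimensional integrals, each of which
    silently takes the value 0 where it diverges. Linearity, comparison and change of order can
    therefore fail for general integrands. They are derived here from the finiteness of the nested
    integral of the absolute value, which controls the inner integrals only almost everywhere; this
    is why signed integrals are reduced to nonnegative ones before anything is exchanged. No decay
    at infinity is assumed either: integrability of a function and of its derivative has to suffice
    for the boundary terms to disappear. Finally, the matrix units are not Hermitian, so the vector
    field leaves the domain of integration. It makes sense only because all directional derivatives
    involved are polynomial in the field and complex linear in the direction. *)

(** * Nested integrals of nonnegative functions: measurability and Tonelli *)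

Section IteratedIntegrals.
Context {R : realType} {K : eqType}.
Local Notation mu := (@lebesgue_measure R).

(** Generators of the product sigma-algebra on [K -> R], for which nested integrals in the
    coordinates have jointly measurable integrands. *)
Definition cylinders : set (set (K -> R)) :=
  [set A | exists k B, measurable B /\ A = (fun x => x k) @^-1` B].

Local Notation X := (g_sigma_algebraType cylinders).

Definition mupd (k : K) (p : X * R) : X := upd (p.1 : K -> R) k p.2.

Lemma measurable_coord (k : K) : measurable_fun setT (fun x : X => (x : K -> R) k).
Proof.
move=> _ B mB; rewrite setTI; apply: sub_sigma_algebra.
by exists k, B.
Qed.

(** Tonelli asks for measurability jointly in the point and the new value. It can be checked on
    cylinders, where the map is either the second projection or a coordinate of the first. *)
Lemma measurable_mupd (k : K) : measurable_fun setT (mupd k).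
Proof.
apply: (measurability (cylinders : set (set X))).
  by [].
move=> _ [_ [k' [B [mB ->]]] <-]; rewrite -comp_preimage.
have -> : (fun x : K -> R => x k') \o mupd k =
    if k' == k then snd else (fun p => (p.1 : K -> R) k').
  by apply/funext => p /=; rewrite /mupd /upd; case: ifP.
case: ifP => _.
  by apply: (measurable_snd (T1:=X)).
by apply: (measurableT_comp (@measurable_coord k') measurable_fst).
Qed.

Lemma measurable_updl (k : K) (x : X) :
  measurable_fun setT (fun t => upd x k t : X).
Proof.
apply: (measurableT_comp (g := fun t : R => (x, t)) (@measurable_mupd k)).
by apply: measurable_fun_pair.
Qed.

Local Open Scope ereal_scope.

Fixpoint eiter (s : seq K) (f : X -> \bar R) (x : X) : \bar R :=
  match s with
  | [::] => f x
  | k :: s' => \int[mu]_t eiter s' f (upd x k t)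
  end.

Implicit Types (s : seq K) (k l : K) (f g : X -> \bar R) (x : X).

Lemma eiter_ge0 s f x : (forall y, 0 <= f y) -> 0 <= eiter s f x.
Proof.
move=> f0; elim: s x => [|k s IH] x //=.
by apply: integral_ge0 => t _; exact: IH.
Qed.

Lemma measurable_eiter s f : (forall y, 0 <= f y) -> measurable_fun setT f ->
  measurable_fun setT (eiter s f).
Proof.
move=> f0 mf; elim: s => [|k s IH] //=.
apply: (@measurable_fun_fubini_tonelli_F _ _ _ _ R mu
  (fun p => eiter s f (mupd k p))).
  exact: (measurableT_comp IH (@measurable_mupd k)).
by move=> p; exact: eiter_ge0.
Qed.

Lemma measurable_eiter_upd s f k x : (forall y, 0 <= f y) ->
  measurable_fun setT f ->
  measurable_fun setT (fun t => eiter s f (upd x k t)).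
Proof.
move=> f0 mf.
by apply: (measurableT_comp (measurable_eiter s f0 mf)); exact: measurable_updl.
Qed.

Lemma le_eiter s f g x : (forall y, 0 <= f y) -> measurable_fun setT f ->
  measurable_fun setT g -> (forall y, f y <= g y) ->
  eiter s f x <= eiter s g x.
Proof.
move=> f0 mf mg fg; have g0 y : 0 <= g y by exact: le_trans (fg y).
elim: s x => [|k s IH] x //=.
apply: ge0_le_integral => //.
- by move=> t _; exact: eiter_ge0.
- exact: measurable_eiter_upd.
- exact: measurable_eiter_upd.
Qed.

Lemma eiterD s f g x : (forall y, 0 <= f y) -> (forall y, 0 <= g y) ->
  measurable_fun setT f -> measurable_fun setT g ->
  eiter s (fun y => f y + g y) x = eiter s f x + eiter s g x.
Proof.
move=> f0 g0 mf mg; elim: s x => [|k s IH] x //=.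
under eq_integral do rewrite IH.
rewrite ge0_integralD//.
- by move=> t _; exact: eiter_ge0.
- exact: measurable_eiter_upd.
- by move=> t _; exact: eiter_ge0.
- exact: measurable_eiter_upd.
Qed.

Lemma eiterZl s (c : R) f x : (0 <= c)%R -> (forall y, 0 <= f y) ->
  measurable_fun setT f ->
  eiter s (fun y => c%:E * f y) x = c%:E * eiter s f x.
Proof.
move=> c0 f0 mf; elim: s x => [|k s IH] x //=.
under eq_integral do rewrite IH.
rewrite ge0_integralZl//.
- exact: measurable_eiter_upd.
- by move=> t _; exact: eiter_ge0.
Qed.

Lemma upd_comm (x : K -> R) k l t u : k != l ->
  upd (upd x k t) l u = upd (upd x l u) k t.
Proof.
move=> kl; apply/funext => m; rewrite /upd.
by case: eqVneq => // ->; case: eqVneq kl => // ->; rewrite eqxx.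
Qed.

Lemma eiter_swap s f k l x : (forall y, 0 <= f y) -> measurable_fun setT f ->
  k != l -> eiter (k :: l :: s) f x = eiter (l :: k :: s) f x.
Proof.
move=> f0 mf kl /=.
rewrite (@fubini_tonelli _ _ _ _ R mu mu
  ((fun p => eiter s f (upd (upd x k p.1) l p.2)) : R * R -> \bar R)) /=.
- by apply: eq_integral => u _; apply: eq_integral => t _; rewrite upd_comm.
- apply: (measurableT_comp (measurable_eiter s f0 mf)).
  apply: (measurableT_comp (@measurable_mupd l)
     (g := fun p : R * R => (upd x k p.1 : X, p.2))).
  apply: measurable_fun_pair => //.
  exact: (measurableT_comp (measurable_updl k x)).
- by move=> p; exact: eiter_ge0.
Qed.

Lemma eiter_cat s s' f x : eiter (s ++ s') f x = eiter s (eiter s' f) x.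
Proof. by elim: s x => //= k s IH x; apply: eq_integral => t _; rewrite IH. Qed.

Lemma eq_eiter s f g x : f =1 g -> eiter s f x = eiter s g x.
Proof. by move=> /funext ->. Qed.

Lemma eiter_rot s f k x : (forall y, 0 <= f y) -> measurable_fun setT f ->
  k \notin s -> eiter (k :: s) f x = eiter (rcons s k) f x.
Proof.
move=> f0 mf; elim: s x => [//|l s IH] x; rewrite inE negb_or => /andP[kl ks].
rewrite eiter_swap//; rewrite [in RHS]/=.
by apply: eq_integral => t _; rewrite -IH.
Qed.

(** With [k] innermost, a one-dimensional fact about the variable [k] can be applied with all other
    variables frozen. *)
Lemma eiter_last s f k x : (forall y, 0 <= f y) -> measurable_fun setT f ->
  uniq s -> k \in s -> eiter s f x = eiter (rcons (rem k s) k) f x.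
Proof.
move=> f0 mf; elim: s x => [//|l s IH] x /=.
case: eqVneq => [-> /andP[ls us] _|lk /andP[ls us]].
  by rewrite -eiter_rot.
rewrite inE => /orP[/eqP kl|ks]; first by rewrite kl eqxx in lk.
by rewrite rcons_cons/=; apply: eq_integral => t _; rewrite IH.
Qed.

End IteratedIntegrals.

(** * Nested integrals of signed real functions *)

Section RealIteratedIntegrals.
Context {R : realType} {K : eqType}.
Local Notation mu := (@lebesgue_measure R).
Local Notation X := (g_sigma_algebraType (@cylinders R K)).
Implicit Types (s : seq K) (k : K) (x : X).

#[local] Instance lebesgue_ae_filter : Filter (nbhs (almost_everywhere mu)).
Proof. exact: (ae_filter_ringOfSetsType mu). Qed.

Lemma ae_fin_num (E : R -> \bar R) : (forall t, 0 <= E t)%E ->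
  measurable_fun setT E -> (\int[mu]_t E t < +oo)%E ->
  {ae mu, forall t, E t \is a fin_num}.
Proof.
move=> E0 mE Eoo.
have /integrable_ae : mu.-integrable setT E.
  apply/integrableP; split=> //.
  by under eq_integral do rewrite gee0_abs//.
by move=> /(_ measurableT); apply: filterS => t /(_ I).
Qed.

(** A finite integral forces [E] to be finite almost everywhere, so [fine] alters it on a null set
    only. *)
Lemma ge0_Rintegral_fine (E : R -> \bar R) : (forall t, 0 <= E t)%E ->
  measurable_fun setT E -> (\int[mu]_t E t < +oo)%E ->
  mu.-integrable setT (EFin \o (fine \o E)) /\
  \int[mu]_t fine (E t) = fine (\int[mu]_t E t)%E.
Proof.
move=> E0 mE Eoo.
have mfE : measurable_fun setT (EFin \o (fine \o E)).
  by apply/measurable_EFinP; exact: measurableT_comp.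
have EE : (\int[mu]_t (EFin \o (fine \o E)) t = \int[mu]_t E t)%E.
  apply: ae_eq_integral => //.
  by apply: filterS (ae_fin_num E0 mE Eoo) => t Et _ /=; rewrite fineK.
split; last by rewrite /Rintegral EE.
apply/integrableP; split=> //; rewrite -EE in Eoo.
by under eq_integral do rewrite gee0_abs ?lee_fin ?fine_ge0//.
Qed.

Fixpoint riter s (f : X -> R) x : R :=
  match s with
  | [::] => f x
  | k :: s' => Rintegral mu setT (fun t => riter s' f (upd x k t))
  end.

(** Each level is [fine] of the difference of the integrals of the positive and negative parts, both
    measurable by Tonelli; divergent inner integrals thus do not spoil measurability. *)
Lemma measurable_riter s f :
  measurable_fun setT f -> measurable_fun setT (riter s f).
Proof.
move=> mf; elim: s => [|k s IH] //=.
have mg : measurable_fun setT (EFin \o (riter s f \o @mupd R K k)).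
  apply/measurable_EFinP; exact: (measurableT_comp IH (@measurable_mupd R K k)).
apply: (measurableT_comp (fine_measurable measurableT)).
rewrite [X in measurable_fun _ X](_ : _ =
  (fubini_F mu ((EFin \o (riter s f \o @mupd R K k))^\+) \-
   fubini_F mu ((EFin \o (riter s f \o @mupd R K k))^\-))%E); last first.
  apply/funext => x; rewrite integralE /fubini_F.
  by congr (_ - _)%E; apply: eq_integral => t _; rewrite unlock.
apply: emeasurable_funB.
  by apply: measurable_fun_fubini_tonelli_F => //; exact: measurable_funepos.
by apply: measurable_fun_fubini_tonelli_F => //; exact: measurable_funeneg.
Qed.

Lemma measurable_riter_upd s f k x : measurable_fun setT f ->
  measurable_fun setT (fun t => riter s f (upd x k t)).
Proof.
move=> mf.
by apply: (measurableT_comp (measurable_riter s mf)); exact: measurable_updl.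
Qed.

(** Here [A] measures where things may go wrong: finiteness of its nested integral passes to the
    next level outside a null set of the current variable, so the points with [A y] infinite never
    influence the value. *)
Lemma riter_ae_eq s (A : X -> \bar R) f g x :
  (forall y, 0 <= A y)%E -> measurable_fun setT A -> (eiter s A x < +oo)%E ->
  measurable_fun setT f -> measurable_fun setT g ->
  (forall y, A y < +oo -> f y = g y)%E -> riter s f x = riter s g x.
Proof.
move=> A0 mA + mf mg fg; elim: s x => [|k s IH] x /=; first exact: fg.
move=> Aoo; congr fine; apply: ae_eq_integral => //.
- by apply/measurable_EFinP; exact: measurable_riter_upd.
- by apply/measurable_EFinP; exact: measurable_riter_upd.
have := ae_fin_num (fun t => eiter_ge0 s _ A0)
  (measurable_eiter_upd s k x A0 mA) Aoo.
apply: filterS => t; rewrite fin_num_abs => At _; rewrite IH//.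
by apply: le_lt_trans At; exact: lee_abs.
Qed.

(** The source of all linearity statements. The induction hypothesis is available only at those [t]
    for which both inner integrals are finite, that is almost everywhere, which is enough under the
    outer integral. *)
Lemma riterB s (u v : X -> R) x : (forall y, 0 <= u y) -> (forall y, 0 <= v y) ->
  measurable_fun setT u -> measurable_fun setT v ->
  (eiter s (EFin \o u) x < +oo)%E -> (eiter s (EFin \o v) x < +oo)%E ->
  riter s (u \- v) x
  = fine (eiter s (EFin \o u) x) - fine (eiter s (EFin \o v) x).
Proof.
move=> u0 v0 mu_ mv.
have eu0 y : (0 <= (EFin \o u) y)%E by rewrite lee_fin.
have ev0 y : (0 <= (EFin \o v) y)%E by rewrite lee_fin.
have meu : measurable_fun setT (EFin \o u) by exact/measurable_EFinP.
have mev : measurable_fun setT (EFin \o v) by exact/measurable_EFinP.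
elim: s x => [|k s IH] x //= uoo voo.
have [iu <-] := ge0_Rintegral_fine (fun t => eiter_ge0 s _ eu0)
  (measurable_eiter_upd s k x eu0 meu) uoo.
have [iv <-] := ge0_Rintegral_fine (fun t => eiter_ge0 s _ ev0)
  (measurable_eiter_upd s k x ev0 mev) voo.
rewrite -RintegralB//; congr fine; apply: ae_eq_integral => //.
- apply/measurable_EFinP; apply: measurable_riter_upd.
  exact: measurable_funB.
- apply/measurable_EFinP; apply: measurable_funB.
    by apply: measurableT_comp => //; exact: measurable_eiter_upd.
  by apply: measurableT_comp => //; exact: measurable_eiter_upd.
have := ae_fin_num (fun t => eiter_ge0 s _ eu0)
  (measurable_eiter_upd s k x eu0 meu) uoo.
have := ae_fin_num (fun t => eiter_ge0 s _ ev0)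
  (measurable_eiter_upd s k x ev0 mev) voo.
apply: filterS2 => t; rewrite !ge0_fin_numE ?eiter_ge0// => vt ut _ /=.
by rewrite IH.
Qed.

End RealIteratedIntegrals.

(** * Vanishing of the integral of a derivative over the line *)

Section IntegralOfDerivative.
Context {R : realType}.
Local Notation mu := (@lebesgue_measure R).

(* Integrate the derivative of [f] times the cutoff [1 - (x / n)^2] over
   [[-n, n]], where it vanishes, and let [n] go to infinity. *)
Lemma Rintegral_derive_eq0 (f df : R -> R) :
  (forall t : R, is_derive t (1 : R) f (df t)) -> continuous df ->
  mu.-integrable setT (EFin \o f) -> mu.-integrable setT (EFin \o df) ->
  Rintegral mu setT df = 0.
Proof.
move=> fdf cdf intf intdf.
have cf : continuous f.
  by move=> t; apply: differentiable_continuous; apply/derivable1_diffP.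
pose e n : R := n.+1%:R^-1.
pose k n x := df x * (1 - (x * e n) ^+ 2) - 2 * (x * e n) * e n * f x.
pose D n : set R := `[- n.+1%:R, n.+1%:R]%classic.
pose F n x := f x * (1 - (x * e n) ^+ 2).
have dF n (t : R) : is_derive t (1 : R) (F n) (k n t).
  rewrite /F /k.
  apply: is_derive_eq.
  rewrite /GRing.scale/=; ring.
have ck n : continuous (k n).
  move=> t; rewrite /k; apply: cvgB.
    apply: cvgM; first exact: cdf.
    apply: cvgB; first exact: cvg_cst.
    by rewrite expr2; apply: cvgM; apply: cvgM => //; exact: cvg_cst.
  apply: cvgM; last exact: cf.
  apply: cvgM; last exact: cvg_cst.
  apply: cvgM; first exact: cvg_cst.
  by apply: cvgM => //; exact: cvg_cst.
have int0 n : (\int[mu]_(x in D n) (k n x)%:E = 0)%E.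
  have N0 : (- n.+1%:R < n.+1%:R :> R) by rewrite gtrN.
  have cF : continuous (F n).
    by move=> t; apply: differentiable_continuous; apply/derivable1_diffP.
  rewrite (continuous_FTC2 (F := F n) N0).
  - rewrite /F /e mulfV ?pnatr_eq0// mulNr mulfV ?pnatr_eq0//.
    by rewrite sqrrN expr1n subrr !mulr0 subee.
  - by apply: continuous_subspaceT => x; exact: ck.
  - split; first by move=> x _; exact: ex_derive.
    + exact/cvg_at_right_filter/cF.
    + exact/cvg_at_left_filter/cF.
  - by move=> x _; rewrite derive1E; exact: derive_val.
pose h n := (EFin \o k n) \_ (D n).
have mD n : measurable (D n) by exact: measurable_itv.
(* On [D n] both [|x * e n|] and [e n] are at most 1, so the cutoff is bounded by 1 and its
   derivative by 2: this gives the dominating function [|df| + 2 |f|]. *)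
have := @dominated_convergence _ _ _ mu setT measurableT h (EFin \o df)
  (fun x => `|(EFin \o df) x| + 2%:E * `|(EFin \o f) x|)%E.
case.
- move=> n; apply/(measurable_restrictT _ (mD n)).
  apply: measurable_funTS; apply/measurable_EFinP.
  exact: continuous_measurable_fun.
- by apply/measurable_EFinP; exact: continuous_measurable_fun.
- apply: aeW => x _.
  have kx : (fun n => k n x) @ \oo --> df x.
    rewrite (_ : (fun n => k n x) =
      fun n => df x - (df x * x ^+ 2 + 2 * x * f x) * (e n * e n)); last first.
      by apply/funext => n; rewrite /k; ring.
    have e0 : e n @[n --> \oo] --> (0 : R) by exact: cvg_harmonic.
    have := cvgB (cvg_cst (df x))
      (cvgM (cvg_cst (df x * x ^+ 2 + 2 * x * f x)) (cvgM e0 e0)).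
    by rewrite !mulr0 subr0; apply.
  have kE : (k n x)%:E @[n --> \oo] --> (df x)%:E.
    by apply/fine_cvgP; split => //; exact: nearW.
  apply: cvg_trans kE.
  apply: near_eq_cvg; near=> n.
  rewrite /h patchE mem_set//= /D/= in_itv/= -ler_norml.
  near: n; exists (Num.bound `|x|) => // n /= xn.
  apply: (le_trans (ltW (archi_boundP (normr_ge0 _)))).
  by rewrite ler_nat (leq_trans xn).
- apply: integrableD => //; first exact: integrable_abse.
  by apply: integrableZl => //; exact: integrable_abse.
- apply: aeW => x n _; rewrite /h patchE; case: ifPn => [|_]; last first.
    by rewrite abse0 adde_ge0// mule_ge0.
  rewrite inE /D/= in_itv/= -ler_norml => xn.
  rewrite /= -EFinM -EFinD lee_fin.
  have e0 : 0 < e n by rewrite invr_gt0.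
  have e1 : e n <= 1 by rewrite invf_le1// ler1n.
  have a1 : `|x * e n| <= 1.
    by rewrite normrM (gtr0_norm e0) ler_pdivrMr// mul1r.
  rewrite /k (le_trans (ler_normB _ _))// lerD//.
    rewrite normrM ler_piMr// ger0_norm ?subr_ge0 ?gerBl ?sqr_ge0//.
    by rewrite -real_normK ?num_real// expr_le1.
  rewrite (normrM _ (f x)) ler_wpM2r// (normrM _ (e n)) (normrM 2).
  rewrite (gtr0_norm e0) (ger0_norm (ler0n _ 2)) -mulrA ler_piMr//.
  by rewrite mulr_ile1// ltW.
move=> _ _.
under eq_fun do rewrite -integral_mkcond int0.
move=> /cvg_lim h0; rewrite /Rintegral -h0//.
by rewrite lim_cst.
Unshelve. all: by end_near. Qed.
End IntegralOfDerivative.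

(** * Linearity, comparison and integration by parts for absolutely integrable functions *)

Section IntegrableFunctions.
Context {R : realType} {K : eqType}.
Local Notation mu := (@lebesgue_measure R).
Local Notation X := (g_sigma_algebraType (@cylinders R K)).
Implicit Types (s : seq K) (k : K) (x : X) (f g h : X -> R).

Local Notation nrm f := (EFin \o (fun y : X => `|f y|%R)).
Local Notation gap f := (fun y : X => (`|f y| - f y)%R).

Definition absolutely_integrable s f x :=
  measurable_fun setT f /\ (eiter s (nrm f) x < +oo)%E.

Local Lemma measurable_abs f : measurable_fun setT f ->
  measurable_fun setT (nrm f).
Proof. by move=> mf; apply/measurable_EFinP; exact: measurableT_comp. Qed.

Local Lemma abs_ge0 f (y : X) : (0 <= (nrm f) y)%E.
Proof. by rewrite lee_fin. Qed.

Lemma absolutely_integrable_abs s f x :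
  absolutely_integrable s f x -> absolutely_integrable s (fun y => `|f y|) x.
Proof.
move=> [mf foo]; split; first exact: measurableT_comp.
by under eq_eiter do rewrite /= normr_id.
Qed.

Lemma absolutely_integrableD s f g x : absolutely_integrable s f x ->
  absolutely_integrable s g x -> absolutely_integrable s (f \+ g) x.
Proof.
move=> [mf foo] [mg goo]; split; first exact: measurable_funD.
apply: (@le_lt_trans _ _ (eiter s (nrm f) x +
   eiter s (nrm g) x)%E); last exact: lte_add_pinfty.
rewrite -eiterD; [|exact: abs_ge0|exact: abs_ge0|exact: measurable_abs|exact: measurable_abs].
apply: le_eiter.
- exact: abs_ge0.
- exact: measurable_abs (measurable_funD mf mg).
- by apply: emeasurable_funD; exact: measurable_abs.
- by move=> y; rewrite lee_fin ler_normD.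
Qed.

Lemma absolutely_integrableZ s c f x : absolutely_integrable s f x ->
  absolutely_integrable s (fun y => c * f y) x.
Proof.
move=> [mf foo]; split; first exact: measurable_funM.
rewrite (@eq_eiter _ _ _ _ (fun y => `|c|%:E * (nrm f) y)%E).
  rewrite eiterZl//; [|exact: abs_ge0|exact: measurable_abs].
  by rewrite lte_mul_pinfty// lee_fin.
by move=> y /=; rewrite normrM EFinM.
Qed.

(** Writing [f] as [|f| - gap f], a difference of two nonnegative integrable functions, turns a
    claim about signed integrals into two Tonelli claims. *)
Lemma riterE s f x : absolutely_integrable s f x ->
  riter s f x = fine (eiter s (nrm f) x)
    - fine (eiter s (EFin \o gap f) x).
Proof.
move=> fi; have [mf foo] := fi.
rewrite -riterB//.
- by congr riter; apply/funext => y /=; rewrite subKr.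
- by move=> y; rewrite subr_ge0 ler_norm.
- exact: measurableT_comp.
- by apply: measurable_funB => //; exact: measurableT_comp.
- have [_] := absolutely_integrableD (absolutely_integrable_abs fi)
    (absolutely_integrableZ (-1) fi).
  apply: le_lt_trans; apply: le_eiter.
  + by move=> y; rewrite lee_fin subr_ge0 ler_norm.
  + apply/measurable_EFinP; apply: measurable_funB => //.
    exact: measurableT_comp.
  + apply: measurable_abs; apply: measurable_funD; first exact: measurableT_comp.
    exact: measurable_funM.
  + by move=> y; rewrite lee_fin /= mulN1r ler_norm.
Qed.

Local Lemma eiter_abs_fin s f x : absolutely_integrable s f x ->
  eiter s (nrm f) x \is a fin_num.
Proof.
by move=> [mf foo]; rewrite ge0_fin_numE//; apply: eiter_ge0; exact: abs_ge0.
Qed.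

Local Lemma absolutely_integrable_gap s f x : absolutely_integrable s f x ->
  absolutely_integrable s (gap f) x.
Proof.
move=> fi; have := absolutely_integrableD (absolutely_integrable_abs fi)
    (absolutely_integrableZ (-1) fi).
by congr (absolutely_integrable _ _ _); apply/funext => y /=; rewrite mulN1r.
Qed.

Local Lemma eiter_gapE s f x :
  eiter s (EFin \o gap f) x =
  eiter s (nrm (gap f)) x.
Proof. by apply: eq_eiter => y /=; rewrite (@ger0_norm _ (_ - _))// subr_ge0 ler_norm. Qed.

(** The sum is regrouped as [(|f| + |g|) - (gap f + gap g)], again a difference of nonnegative
    functions, to which [riterB] applies even though [|f| + |g|] is not [|f + g|]. *)
Lemma riterD s f g x : absolutely_integrable s f x ->
  absolutely_integrable s g x ->
  riter s (f \+ g) x = riter s f x + riter s g x.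
Proof.
move=> fi gi.
have gfi := absolutely_integrable_gap fi.
have ggi := absolutely_integrable_gap gi.
rewrite (riterE fi) (riterE gi) addrACA -opprD.
rewrite !eiter_gapE -!fineD ?eiter_abs_fin//.
rewrite -!eiterD; try exact: abs_ge0; try exact: measurable_abs gfi.1;
  try exact: measurable_abs ggi.1; try exact: measurable_abs fi.1;
  try exact: measurable_abs gi.1.
have e1 : (fun y : X => (nrm f) y + (nrm g) y)%E
  = EFin \o (fun y => `|f y| + `|g y|)%R by apply/funext.
have e2 : (fun y : X => (nrm (gap f)) y
     + (nrm (gap g)) y)%E
  = EFin \o (fun y => `|gap f y| + `|gap g y|)%R by apply/funext.
rewrite e1 e2 -riterB.
- congr riter; apply/funext => y /=.
  rewrite !(@ger0_norm _ (_ - _)) ?subr_ge0 ?ler_norm//.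
  by rewrite opprD addrACA !subKr.
- by move=> y; rewrite addr_ge0.
- by move=> y; rewrite addr_ge0.
- by apply: measurable_funD; apply: measurableT_comp => //; [exact: fi.1|exact: gi.1].
- by apply: measurable_funD; apply: measurableT_comp => //; [exact: gfi.1|exact: ggi.1].
- rewrite -e1 eiterD; [|exact: abs_ge0|exact: abs_ge0|exact: measurable_abs fi.1|exact: measurable_abs gi.1].
  by rewrite lte_add_pinfty//; [exact: fi.2|exact: gi.2].
- rewrite -e2 eiterD; [|exact: abs_ge0|exact: abs_ge0|exact: measurable_abs gfi.1|exact: measurable_abs ggi.1].
  by rewrite lte_add_pinfty//; [exact: gfi.2|exact: ggi.2].
Qed.

Lemma riter0 s x : riter s (fun=> 0) x = 0.
Proof.
elim: s x => [|k s IH] x //=.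
rewrite (_ : (fun t => _) = fun=> 0); last by apply/funext => t; rewrite IH.
by rewrite /Rintegral integral0.
Qed.

Lemma riterN s f x : absolutely_integrable s f x ->
  riter s (fun y => - f y) x = - riter s f x.
Proof.
move=> fi.
have nfi : absolutely_integrable s (fun y => - f y) x.
  have := absolutely_integrableZ (-1) fi.
  by congr (absolutely_integrable _ _ _); apply/funext => y /=; rewrite mulN1r.
apply/eqP; rewrite -addr_eq0 -riterD//.
by rewrite (_ : _ \+ _ = fun=> 0) ?riter0//; apply/funext => y; rewrite /= addNr.
Qed.

Local Lemma riterZ_ge0 s c f x : 0 <= c -> absolutely_integrable s f x ->
  riter s (fun y => c * f y) x = c * riter s f x.
Proof.
move=> c0 fi; have cfi := absolutely_integrableZ c fi.
have gfi := absolutely_integrable_gap fi.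
rewrite (riterE fi) (riterE cfi) mulrBr !eiter_gapE.
have E g : absolutely_integrable s g x ->
    fine (eiter s (nrm (fun y => c * g y)%R) x) =
    c * fine (eiter s (nrm g) x).
  move=> gi; rewrite -[c]/(fine c%:E) -fineM ?eiter_abs_fin//.
  rewrite -eiterZl//; [|exact: abs_ge0|exact: measurable_abs gi.1].
  congr fine; apply: eq_eiter => y /=.
  by rewrite normrM EFinM ger0_norm.
rewrite -!E//; congr (_ - fine _); apply: eq_eiter => y /=.
by rewrite normrM ger0_norm// mulrBr.
Qed.

Lemma riterZ s c f x : absolutely_integrable s f x ->
  riter s (fun y => c * f y) x = c * riter s f x.
Proof.
move=> fi; have [c0|c0] := leP 0 c; first exact: riterZ_ge0.
rewrite -[c]opprK mulNr -riterZ_ge0 ?oppr_ge0 ?ltW// -riterN.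
  by congr riter; apply/funext => y; rewrite mulNr.
exact: absolutely_integrableZ.
Qed.

Lemma riter_ge0 s f x : (forall y, 0 <= f y) -> 0 <= riter s f x.
Proof.
move=> f0; elim: s x => [|k s IH] x //=.
by apply: fine_ge0; apply: integral_ge0 => t _; rewrite lee_fin.
Qed.

Lemma normr_riter_le s f g x : absolutely_integrable s f x ->
  absolutely_integrable s g x -> (forall y, `|f y| <= g y) ->
  `|riter s f x| <= riter s g x.
Proof.
move=> fi gi fg.
have mfi : absolutely_integrable s (fun y => - f y) x.
  have := absolutely_integrableZ (-1) fi.
  by congr (absolutely_integrable _ _ _); apply/funext => y /=; rewrite mulN1r.
have lb : 0 <= riter s f x + riter s g x.
  rewrite -riterD//; apply: riter_ge0 => y /=.
  by rewrite -lerBlDl sub0r (le_trans (ler_norm _))// normrN.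
have ub : 0 <= riter s g x - riter s f x.
  rewrite -riterN// -riterD//; apply: riter_ge0 => y /=.
  by rewrite subr_ge0 (le_trans (ler_norm _)).
by rewrite ler_norml; lra.
Qed.

Lemma riter_last s f k x : uniq s -> k \in s -> absolutely_integrable s f x ->
  absolutely_integrable (rcons (rem k s) k) f x /\
  riter s f x = riter (rcons (rem k s) k) f x.
Proof.
move=> us ks fi.
have gfi := absolutely_integrable_gap fi.
have fi' : absolutely_integrable (rcons (rem k s) k) f x.
  split; first exact: fi.1.
  rewrite -eiter_last//; [exact: fi.2|exact: abs_ge0|exact: measurable_abs fi.1].
split=> //; rewrite (riterE fi) (riterE fi') !eiter_gapE; congr (fine _ - fine _).
  by apply: eiter_last => //; [exact: abs_ge0|exact: measurable_abs fi.1].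
by apply: eiter_last => //; [exact: abs_ge0|exact: measurable_abs gfi.1].
Qed.

Lemma riter_cat s s' f x : riter (s ++ s') f x = riter s (riter s' f) x.
Proof.
elim: s x => //= k s IH x.
by congr fine; apply: eq_integral => t _; rewrite IH.
Qed.

(** After [k] is moved innermost, the innermost integral is that of a derivative on the line and
    vanishes for almost all values of the other variables. *)
Lemma riter_partial_derivative s k f df x : uniq s -> k \in s ->
  (forall y (t : R), is_derive t (1 : R) (fun t => f (upd y k t)) (df (upd y k t))) ->
  (forall y, continuous (fun t : R => df (upd y k t) : R)) ->
  absolutely_integrable s f x -> absolutely_integrable s df x ->
  riter s df x = 0.
Proof.
move=> us ks fdf cdf /(riter_last us ks)[[mf foo] _].
move=> /(riter_last us ks)[[mdf dfoo] ->].
set s' := rem k s in foo dfoo *.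
rewrite -cats1 riter_cat -(riter0 s' x).
(* Finite exactly when [f] and [df] are both integrable along the line through [y] in direction [k],
   as the one-dimensional lemma requires. *)
pose A (y : X) := (eiter [:: k] (nrm f) y +
                  eiter [:: k] (nrm df) y)%E.
have A1 y : (0 <= eiter [:: k] (nrm f) y)%E.
  by apply: eiter_ge0; exact: abs_ge0.
have A2 y : (0 <= eiter [:: k] (nrm df) y)%E.
  by apply: eiter_ge0; exact: abs_ge0.
have mA1 : measurable_fun setT (eiter [:: k] (nrm f)).
  by apply: measurable_eiter; [exact: abs_ge0|exact: measurable_abs].
have mA2 : measurable_fun setT (eiter [:: k] (nrm df)).
  by apply: measurable_eiter; [exact: abs_ge0|exact: measurable_abs].
apply: (@riter_ae_eq _ _ _ A) => //.
- by move=> y; exact: adde_ge0.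
- exact: emeasurable_funD.
- by rewrite eiterD// -!eiter_cat cats1 lte_add_pinfty.
- exact: (@measurable_riter _ _ [:: k]).
move=> y Ay /=.
apply: (@Rintegral_derive_eq0 _ (fun t => f (upd y k t))) => //.
- apply/integrableP; split.
    apply/measurable_EFinP.
    exact: (@measurable_riter_upd _ _ [::]).
  apply: le_lt_trans Ay; exact: leeDl.
- apply/integrableP; split.
    apply/measurable_EFinP.
    exact: (@measurable_riter_upd _ _ [::]).
  apply: le_lt_trans Ay; exact: leeDr.
Qed.

End IntegrableFunctions.

(** * Norms, measurability and differentiation of complex-valued functions *)

Section ComplexFunctions.
Context {R : realType}.
Local Notation C := R[i].
Local Notation Re := complex.Re.
Local Notation Im := complex.Im.

Lemma ReD (z w : C) : Re (z + w) = Re z + Re w. Proof. by case: z w => ? ? []. Qed.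
Lemma ImD (z w : C) : Im (z + w) = Im z + Im w. Proof. by case: z w => ? ? []. Qed.
Lemma ReM (z w : C) : Re (z * w) = Re z * Re w - Im z * Im w.
Proof. by case: z w => ? ? []. Qed.
Lemma ImM (z w : C) : Im (z * w) = Re z * Im w + Im z * Re w.
Proof. by case: z w => ? ? []. Qed.

Lemma cexpD (z w : C) : cexp (z + w) = cexp z * cexp w.
Proof.
case: z w => a b [c d]; apply/eqP; rewrite eq_complex /cexp /=.
by rewrite expRD cosD sinD; apply/andP; split; apply/eqP; ring.
Qed.

(** Equivalent to [normc] up to a factor 2, and additive in the real and imaginary parts, which are
    integrated separately. *)
Definition cnorm1 (z : C) : R := `|Re z| + `|Im z|.

Lemma normc_le_cnorm1 (z : C) : Normc.normc z <= cnorm1 z.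
Proof.
case: z => a b; rewrite /cnorm1 /= -[leRHS]ger0_norm ?addr_ge0//.
rewrite -sqrtr_sqr ler_wsqrtr// sqrrD !real_normK ?num_real//.
by rewrite addrAC lerDl mulrn_wge0// mulr_ge0.
Qed.

Lemma Re_le_normc (z : C) : `|Re z| <= Normc.normc z.
Proof.
by case: z => a b /=; rewrite -sqrtr_sqr ler_wsqrtr// lerDl sqr_ge0.
Qed.

Lemma Im_le_normc (z : C) : `|Im z| <= Normc.normc z.
Proof.
by case: z => a b /=; rewrite -sqrtr_sqr ler_wsqrtr// lerDr sqr_ge0.
Qed.

Lemma cnorm1_le_normc (z : C) : cnorm1 z <= 2 * Normc.normc z.
Proof. by rewrite mulr2n mulrDl mul1r lerD ?Re_le_normc ?Im_le_normc. Qed.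

Section Measurability.
Context d (T : measurableType d).
Implicit Types f g : T -> C.

Definition cmeasurable f :=
  measurable_fun setT (fun x => Re (f x)) /\
  measurable_fun setT (fun x => Im (f x)).

Lemma cmeasurable_cst c : cmeasurable (fun=> c).
Proof. by split. Qed.

Lemma cmeasurableD f g : cmeasurable f -> cmeasurable g ->
  cmeasurable (fun x => f x + g x).
Proof.
move=> [f1 f2] [g1 g2]; split.
  by under eq_fun do rewrite ReD; exact: measurable_funD.
by under eq_fun do rewrite ImD; exact: measurable_funD.
Qed.

Lemma cmeasurableM f g : cmeasurable f -> cmeasurable g ->
  cmeasurable (fun x => f x * g x).
Proof.
move=> [f1 f2] [g1 g2]; split.
  by under eq_fun do rewrite ReM; apply: measurable_funB; exact: measurable_funM.
by under eq_fun do rewrite ImM; apply: measurable_funD; exact: measurable_funM.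
Qed.

Lemma cmeasurable_cexp f : cmeasurable f -> cmeasurable (fun x => cexp (f x)).
Proof.
move=> [f1 f2].
have mcos : measurable_fun setT (@cos R).
  by apply: continuous_measurable_fun; exact: continuous_cos.
have msin : measurable_fun setT (@sin R).
  by apply: continuous_measurable_fun; exact: continuous_sin.
have mexp : measurable_fun setT (@expR R).
  by apply: continuous_measurable_fun; exact: continuous_expR.
by split; apply: measurable_funM; apply: measurableT_comp.
Qed.

End Measurability.

Section Calculus.
Implicit Types f g df dg : R -> C.

(** The variable is real and only the values are complex, so a pair of real derivatives matches the
    componentwise definition of the integral. *)
Definition cderive f df := forall t : R,
  is_derive t (1 : R) (fun t : R => Re (f t)) (Re (df t)) /\
  is_derive t (1 : R) (fun t : R => Im (f t)) (Im (df t)).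

Lemma cderive_cst c : cderive (fun=> c) (fun=> 0).
Proof. by move=> t; split; exact: is_derive_cst. Qed.

Lemma cderiveD f g df dg : cderive f df -> cderive g dg ->
  cderive (fun t => f t + g t) (fun t => df t + dg t).
Proof.
move=> fdf gdg t; have [? ?] := fdf t; have [? ?] := gdg t; split.
  by under eq_fun do rewrite ReD; rewrite ReD; exact: is_deriveD.
by under eq_fun do rewrite ImD; rewrite ImD; exact: is_deriveD.
Qed.

Lemma cderiveM f g df dg : cderive f df -> cderive g dg ->
  cderive (fun t => f t * g t) (fun t => df t * g t + f t * dg t).
Proof.
move=> fdf gdg t; have [? ?] := fdf t; have [? ?] := gdg t; split.
  under eq_fun do rewrite ReM; rewrite ReD !ReM; apply: is_derive_eq.
  by rewrite /GRing.scale /=; ring.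
under eq_fun do rewrite ImM; rewrite ImD !ImM; apply: is_derive_eq.
by rewrite /GRing.scale /=; ring.
Qed.

Lemma cderive_cexp f df : cderive f df ->
  cderive (fun t => cexp (f t)) (fun t => df t * cexp (f t)).
Proof.
move=> fdf t; have [? ?] := fdf t; rewrite /cexp; split => /=.
  rewrite ReM/=; apply: is_derive_eq.
  by rewrite /GRing.scale /=; ring.
rewrite ImM/=; apply: is_derive_eq.
by rewrite /GRing.scale /=; ring.
Qed.

Definition ccontinuous f :=
  continuous (fun t : R => Re (f t) : R) /\ continuous (fun t : R => Im (f t) : R).

Lemma cderive_ccontinuous f df : cderive f df -> ccontinuous f.
Proof.
move=> fdf; split=> t; have [? ?] := fdf t;
  by apply: differentiable_continuous; apply/derivable1_diffP.
Qed.

End Calculus.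

End ComplexFunctions.

(** * Nested integrals of complex functions *)

Section ComplexIteratedIntegrals.
Context {R : realType} {K : eqType}.
Local Notation C := R[i].
Local Notation Re := complex.Re.
Local Notation Im := complex.Im.
Local Notation X := (g_sigma_algebraType (@cylinders R K)).
Implicit Types (s : seq K) (k : K) (x : X) (f g : X -> C).

Lemma iterintE s f x : iterint s f x =
  riter s (fun y => Re (f y)) x +i* riter s (fun y => Im (f y)) x.
Proof.
elim: s x => [|k s IH] x /=; first by case: (f x).
by rewrite /cint; congr (_ +i* _); congr fine; apply: eq_integral => t _;
  rewrite IH.
Qed.

Lemma iterint_absE s (h : X -> R) x : iterint_abs s h x = eiter s (EFin \o h) x.
Proof. by elim: s x => //= k s IH x; apply: eq_integral => t _; rewrite IH. Qed.

Definition cintegrable s f x :=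
  absolutely_integrable s (fun y => Re (f y)) x /\
  absolutely_integrable s (fun y => Im (f y)) x.

Lemma cintegrable_normc s f x : cmeasurable f ->
  (iterint_abs s (fun y => Normc.normc (f y)) x < +oo)%E -> cintegrable s f x.
Proof.
move=> [mRe mIm]; rewrite iterint_absE => foo.
have mn : measurable_fun setT (EFin \o (fun y => Normc.normc (f y))).
  apply/measurable_EFinP.
  rewrite (_ : (fun _ => _) =
    @Num.sqrt R \o (fun y => Re (f y) ^+ 2 + Im (f y) ^+ 2)); last first.
    by apply/funext => y /=; case: (f y).
  apply: measurableT_comp.
    by apply: continuous_measurable_fun; exact: sqrt_continuous.
  by apply: measurable_funD; exact: measurable_funX.
split; split=> //; apply: le_lt_trans foo; apply: le_eiter => //.
- by move=> y; rewrite lee_fin.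
- by apply/measurable_EFinP; exact: measurableT_comp.
- by move=> y; rewrite lee_fin Re_le_normc.
- by move=> y; rewrite lee_fin.
- by apply/measurable_EFinP; exact: measurableT_comp.
- by move=> y; rewrite lee_fin Im_le_normc.
Qed.

Lemma cintegrableD s f g x : cintegrable s f x -> cintegrable s g x ->
  cintegrable s (fun y => f y + g y) x.
Proof.
move=> [f1 f2] [g1 g2]; split.
  by under eq_fun do rewrite ReD; exact: absolutely_integrableD.
by under eq_fun do rewrite ImD; exact: absolutely_integrableD.
Qed.

Lemma cintegrableZ s c f x : cintegrable s f x ->
  cintegrable s (fun y => c * f y) x.
Proof.
move=> [f1 f2]; split.
  under eq_fun do rewrite ReM -mulNr.
  by apply: absolutely_integrableD; exact: absolutely_integrableZ.
under eq_fun do rewrite ImM.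
by apply: absolutely_integrableD; exact: absolutely_integrableZ.
Qed.

Lemma iterintD s f g x : cintegrable s f x -> cintegrable s g x ->
  iterint s (fun y => f y + g y) x = iterint s f x + iterint s g x.
Proof.
move=> [f1 f2] [g1 g2]; rewrite !iterintE.
under eq_fun do rewrite ReD; under [in X in _ +i* X]eq_fun do rewrite ImD.
by rewrite (riterD f1 g1) (riterD f2 g2).
Qed.

Lemma iterintZ s c f x : cintegrable s f x ->
  iterint s (fun y => c * f y) x = c * iterint s f x.
Proof.
move=> [f1 f2]; rewrite !iterintE.
under eq_fun do rewrite ReM -mulNr.
under [in X in _ +i* X]eq_fun do rewrite ImM.
rewrite riterD; [|exact: absolutely_integrableZ|exact: absolutely_integrableZ].
rewrite riterD; [|exact: absolutely_integrableZ|exact: absolutely_integrableZ].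
by rewrite !riterZ// mulNr; case: c.
Qed.

Lemma cintegrable_cnorm1 s f x : cintegrable s f x ->
  absolutely_integrable s (fun y => cnorm1 (f y)) x.
Proof.
by move=> [f1 f2]; apply: absolutely_integrableD; exact: absolutely_integrable_abs.
Qed.

(** The integrals of the real and imaginary parts are each bounded by that of [b], whence the factor
    2. *)
Lemma normc_iterint_le s f (b : X -> R) x : cintegrable s f x ->
  absolutely_integrable s b x -> (forall y, cnorm1 (f y) <= b y) ->
  Normc.normc (iterint s f x) <= 2 * riter s b x.
Proof.
move=> [f1 f2] bi fb; apply: le_trans (normc_le_cnorm1 _) _.
rewrite iterintE /cnorm1/= mulr2n mulrDl mul1r lerD//; apply: normr_riter_le => // y.
  by rewrite (le_trans _ (fb y))// lerDl.
by rewrite (le_trans _ (fb y))// lerDr.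
Qed.

Lemma iterint_partial_derivative s k f df x : uniq s -> k \in s ->
  (forall y, cderive (fun t => f (upd y k t)) (fun t => df (upd y k t))) ->
  (forall y, ccontinuous (fun t => df (upd y k t))) ->
  cintegrable s f x -> cintegrable s df x ->
  iterint s df x = 0.
Proof.
move=> us ks fdf cdf [f1 f2] [df1 df2]; rewrite iterintE.
rewrite (riter_partial_derivative us ks _ _ f1 df1).
- rewrite (riter_partial_derivative us ks _ _ f2 df2)//.
  + by move=> y t; have [] := fdf y t.
  + by move=> y; have [] := cdf y.
- by move=> y t; have [] := fdf y t.
- by move=> y; have [] := cdf y.
Qed.

End ComplexIteratedIntegrals.

(** * Polynomial functions of a matrix and coordinate directions of Hermitian matrices *)

Section MatrixFunctions.
Context {R : realType} {L : nat}.
Local Notation C := R[i].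
Local Notation M := 'M[C]_L.
Local Notation K := ('I_L * 'I_L)%type.
Local Notation X := (g_sigma_algebraType (@cylinders R K)).

(** A predicate on functions rather than a type of polynomials, so that measurability,
    differentiability and integrability against the weight follow by induction on how the function
    is built. *)
Inductive polyfun : (M -> C) -> Prop :=
| polyfun_cst c : polyfun (fun=> c)
| polyfun_entry i j : polyfun (fun phi => phi i j)
| polyfunD P Q : polyfun P -> polyfun Q -> polyfun (fun phi => P phi + Q phi)
| polyfunM P Q : polyfun P -> polyfun Q -> polyfun (fun phi => P phi * Q phi).

Lemma polyfun_sum (I : Type) (s : seq I) (F : I -> M -> C) :
  (forall i, polyfun (F i)) -> polyfun (fun phi => \sum_(i <- s) F i phi).
Proof.
move=> pF; elim: s => [|i s IH].
  by under eq_fun do rewrite big_nil; exact: polyfun_cst.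
by under eq_fun do rewrite big_cons; exact: polyfunD.
Qed.

Lemma polyfunN P : polyfun P -> polyfun (fun phi => - P phi).
Proof.
by move=> pP; under eq_fun do rewrite -mulN1r; apply: polyfunM => //; exact: polyfun_cst.
Qed.

Lemma polyfunZ c P : polyfun P -> polyfun (fun phi => c * P phi).
Proof. by move=> pP; apply: polyfunM => //; exact: polyfun_cst. Qed.

Definition polymx (A : M -> M) := forall i j, polyfun (fun phi => A phi i j).

Lemma polymx_mul A B : polymx A -> polymx B -> polymx (fun phi => A phi *m B phi).
Proof.
move=> pA pB i j; under eq_fun do rewrite mxE.
by apply: polyfun_sum => k; exact: polyfunM.
Qed.

Lemma polymx_exp k : polymx (fun phi => phi ^+ k).
Proof.
elim: k => [|k IH].
  by move=> i j; under eq_fun do rewrite expr0; exact: polyfun_cst.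
under eq_fun do rewrite exprS -mulmxE.
by apply: polymx_mul => // i j; exact: polyfun_entry.
Qed.

Lemma polyfun_tr A : polymx A -> polyfun (fun phi => \tr (A phi)).
Proof. by move=> pA; apply: polyfun_sum => i; exact: pA. Qed.

Definition mxderive (A dA : R -> M) :=
  forall i j, cderive (fun t => A t i j) (fun t => dA t i j).

Lemma eq_cderive (f g df dg : R -> C) : f =1 g -> df =1 dg ->
  cderive g dg -> cderive f df.
Proof. by move=> /funext -> /funext ->. Qed.

Lemma cderive_sum (I : Type) (s : seq I) (f df : I -> R -> C) :
  (forall i, cderive (f i) (df i)) ->
  cderive (fun t => \sum_(i <- s) f i t) (fun t => \sum_(i <- s) df i t).
Proof.
move=> fdf; elim: s => [|i s IH].
  by apply: eq_cderive (cderive_cst 0) => t; rewrite big_nil.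
by apply: eq_cderive (cderiveD (fdf i) IH) => t; rewrite big_cons.
Qed.

Lemma cderiveZ c (f df : R -> C) : cderive f df ->
  cderive (fun t => c * f t) (fun t => c * df t).
Proof.
move=> fdf; apply: eq_cderive (cderiveM (cderive_cst c) fdf) => // t.
by rewrite mul0r add0r.
Qed.

Lemma mxderive_mul A B dA dB : mxderive A dA -> mxderive B dB ->
  mxderive (fun t => A t *m B t) (fun t => dA t *m B t + A t *m dB t).
Proof.
move=> AdA BdB i j.
apply: eq_cderive (cderive_sum (index_enum 'I_L)
  (fun k => cderiveM (AdA i k) (BdB k j))) => t; first by rewrite mxE.
by rewrite !mxE -big_split.
Qed.

(** This is the sum of [phi ^+ i * H * phi ^+ (k - 1 - i)] over [i < k], in the recursive form that
    the Leibniz rule produces. *)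
Fixpoint dexp (k : nat) (phi H : M) : M :=
  if k is k'.+1 then H * phi ^+ k' + phi * dexp k' phi H else 0.

Lemma mxderive_exp k (phi dphi : R -> M) : mxderive phi dphi ->
  mxderive (fun t => phi t ^+ k) (fun t => dexp k (phi t) (dphi t)).
Proof.
move=> dphiP; elim: k => [|k IH].
  by move=> i j; apply: eq_cderive (cderive_cst ((1 : M) i j)) => t; rewrite ?mxE.
move=> i j; apply: eq_cderive (mxderive_mul dphiP IH i j) => // t.
by rewrite exprS -mulmxE.
Qed.

Lemma mxtrace_dexp k phi H : \tr (dexp k phi H) = k%:R * \tr (H * phi ^+ k.-1).
Proof.
(* The power in front makes the induction close: the recursive call of [dexp] comes multiplied by
   [phi], which is absorbed into [j], while cyclicity handles the head term. *)
suff E j : \tr (phi ^+ j * dexp k phi H) = k%:R * \tr (H * phi ^+ (j + k).-1).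
  by have := E 0%N; rewrite expr0 mul1r add0n.
have trC (A B : M) : \tr (A * B) = \tr (B * A) := mxtrace_mulC A B.
elim: k j => [|k IH] j; first by rewrite /= mulr0 mul0r linear0.
rewrite /= mulrDr linearD/= trC -mulrA -exprD mulrA -exprSr IH.
by rewrite addnS addSn/= [(k + j)%N]addnC -natr1 mulrDl mul1r addrC.
Qed.

Lemma mxderive_tr A dA : mxderive A dA ->
  cderive (fun t => \tr (A t)) (fun t => \tr (dA t)).
Proof. by move=> AdA; apply: cderive_sum => i; exact: AdA. Qed.

(** The velocity of [herm] along the [k]-th coordinate line, constant because [herm] is real
    linear. *)
Definition herm_dir (k : K) : M := herm (upd (fun=> 0) k 1).

Lemma herm_updE (x : K -> R) k t i j :
  herm (upd x k t) i j = herm (upd x k 0) i j + t%:C * herm_dir k i j.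
Proof.
rewrite !mxE /upd; case: ifP => _; first by case: ifP => _; apply/eqP;
  rewrite eq_complex /=; apply/andP; split; apply/eqP; ring.
by case: ifP => _; case: ifP => _; case: ifP => _; apply/eqP;
  rewrite eq_complex /=; apply/andP; split; apply/eqP; ring.
Qed.

Lemma mxderive_herm (x : K -> R) k :
  mxderive (fun t => herm (upd x k t)) (fun=> herm_dir k).
Proof.
move=> i j.
have d1 : cderive (fun t : R => t%:C) (fun=> 1).
  by move=> t; split => /=; [exact: is_derive_id|exact: is_derive_cst].
apply: eq_cderive (cderiveD (cderive_cst (herm (upd x k 0) i j))
  (cderiveM d1 (cderive_cst (herm_dir k i j)))) => t; first exact: herm_updE.
by rewrite add0r mul1r mulr0 addr0.
Qed.

Lemma cmeasurable_herm i j : cmeasurable (fun x : X => herm (x : K -> R) i j).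
Proof.
have m := @measurable_coord R K.
have -> : (fun x : X => herm (x : K -> R) i j) = fun x : X =>
    if i == j then (x : K -> R) (i, i) +i* 0
    else if (i < j)%N then (x : K -> R) (i, j) +i* (x : K -> R) (j, i)
    else (x : K -> R) (j, i) -i* (x : K -> R) (i, j).
  by apply/funext => x; rewrite mxE.
case: (i == j); first by split => //=; exact: m.
case: (i < j)%N; split => /=; try exact: m.
by apply: measurableT_comp => //; exact: m.
Qed.

Lemma cmeasurable_polyfun P : polyfun P ->
  cmeasurable (fun x : X => P (herm (x : K -> R))).
Proof.
elim=> [c|i j|{}P Q _ mP _ mQ|{}P Q _ mP _ mQ].
- exact: cmeasurable_cst.
- exact: cmeasurable_herm.
- exact: cmeasurableD.
- exact: cmeasurableM.
Qed.

(** The derivative is left unspecified: its existence serves to obtain continuity of the integrand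
    along coordinate lines. *)
Lemma cderive_polyfun P (phi dphi : R -> M) : polyfun P -> mxderive phi dphi ->
  exists dP, cderive (fun t => P (phi t)) dP.
Proof.
move=> + dphiP; elim=> [c|i j|{}P Q _ [dP dPP] _ [dQ dQP]|{}P Q _ [dP dPP] _ [dQ dQP]].
- by exists (fun=> 0); exact: cderive_cst.
- by exists (fun t => dphi t i j); exact: dphiP.
- by eexists; exact: cderiveD dPP dQP.
- by eexists; exact: cderiveM dPP dQP.
Qed.

Lemma herm_dir_diag (i : 'I_L) : herm_dir (i, i) = delta_mx i i.
Proof.
apply/matrixP => a b; rewrite !mxE /upd !xpair_eqE.
case: (eqVneq a b) => [<-|ab]; first by rewrite andbb; case: ifP.
have -> : (a == i) && (b == i) = false.
  by apply/negbTE/negP => /andP[/eqP ai /eqP bi]; rewrite ai bi eqxx in ab.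
have -> : (b == i) && (a == i) = false.
  by apply/negbTE/negP => /andP[/eqP bi /eqP ai]; rewrite ai bi eqxx in ab.
by case: ifP => _; rewrite ?oppr0.
Qed.

Lemma herm_dir_re (i j : 'I_L) : (i < j)%N ->
  herm_dir (i, j) = delta_mx i j + delta_mx j i.
Proof.
move=> ij; have nij : (i == j) = false by rewrite -val_eqE ltn_eqF.
have nji : (j == i) = false by rewrite eq_sym.
have ji : (j < i)%N = false by rewrite ltnNge ltnW.
apply/matrixP => a b; rewrite !mxE /upd !xpair_eqE.
case: (eqVneq a b) => [<-|ab].
  case: (eqVneq a i) => [e|_]; rewrite ?e ?nij ?nji ?eqxx ?andbF /=;
    do ?case: ifP => ?; apply/eqP; rewrite eq_complex /=; apply/andP; split; apply/eqP; ring.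
case: (eqVneq a i) => [e|_]; rewrite ?e ?eqxx ?nij ?nji ?ij ?ji ?andbT ?andbF /=;
case: (eqVneq b j) => [e'|_]; rewrite ?e' ?eqxx ?nij ?nji ?ij ?ji ?andbT ?andbF /=;
case: (eqVneq a j) => [e''|_]; rewrite ?e'' ?eqxx ?nij ?nji ?ij ?ji ?andbT ?andbF /=;
case: (eqVneq b i) => [e'''|_]; rewrite ?e''' ?eqxx ?nij ?nji ?ij ?ji ?andbT ?andbF /=;
  do ?case: ifP => ?; apply/eqP; rewrite eq_complex /=; apply/andP; split;
  apply/eqP; ring.
Qed.

(** For [i < j] the imaginary part of the entry [(i, j)] is the coordinate stored at [(j, i)], hence
    the reversed index. *)
Lemma herm_dir_im (i j : 'I_L) : (i < j)%N ->
  herm_dir (j, i) = 'i *: (delta_mx i j - delta_mx j i).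
Proof.
move=> ij; have nij : (i == j) = false by rewrite -val_eqE ltn_eqF.
have nji : (j == i) = false by rewrite eq_sym.
have ji : (j < i)%N = false by rewrite ltnNge ltnW.
apply/matrixP => a b; rewrite !mxE /upd !xpair_eqE.
case: (eqVneq a b) => [<-|ab].
  case: (eqVneq a i) => [e|_]; rewrite ?e ?nij ?nji ?eqxx ?andbF /=;
    do ?case: ifP => ?; apply/eqP; rewrite eq_complex /=; apply/andP; split; apply/eqP; ring.
case: (eqVneq a i) => [e|_]; rewrite ?e ?eqxx ?nij ?nji ?ij ?ji ?andbT ?andbF /=;
case: (eqVneq b j) => [e'|_]; rewrite ?e' ?eqxx ?nij ?nji ?ij ?ji ?andbT ?andbF /=;
case: (eqVneq a j) => [e''|_]; rewrite ?e'' ?eqxx ?nij ?nji ?ij ?ji ?andbT ?andbF /=;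
case: (eqVneq b i) => [e'''|_]; rewrite ?e''' ?eqxx ?nij ?nji ?ij ?ji ?andbT ?andbF /=;
  do ?case: ifP => ?; apply/eqP; rewrite eq_complex /=; apply/andP; split;
  apply/eqP; ring.
Qed.

(* [(d/dRe phi_ij -+ i d/dIm phi_ij) / 2] are the derivatives in the directions
   of the matrix units. *)
Lemma delta_mx_herm_ind (Q : M -> Prop) : (forall k, Q (herm_dir k)) ->
  (forall c A, Q A -> Q (c *: A)) -> (forall A B, Q A -> Q B -> Q (A + B)) ->
  forall i j, Q (delta_mx i j).
Proof.
move=> Qk QZ QD.
have half (A : M) : A = 2^-1 *: (A + A).
  by rewrite -mulr2n -[A *+ 2]scaler_nat scalerA mulVf ?scale1r// pnatr_eq0.
suff lt (i j : 'I_L) : (i < j)%N -> Q (delta_mx i j) /\ Q (delta_mx j i).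
  move=> i j; case: (ltngtP i j) => [/lt[]//|/lt[]//|/val_inj ->].
  by rewrite -herm_dir_diag.
move=> ij; have re := herm_dir_re ij; have im := herm_dir_im ij.
have ii : 'i * 'i = -1 :> C by rewrite -expr2 sqr_i.
split.
  rewrite (half (delta_mx i j)); apply: (QZ).
  have -> : delta_mx i j + delta_mx i j = herm_dir (i, j) + (- 'i) *: herm_dir (j, i).
    by rewrite re im scalerA mulNr ii opprK scale1r addrACA subrr addr0.
  by apply: (QD) => //; exact: (QZ).
rewrite (half (delta_mx j i)); apply: (QZ).
have -> : delta_mx j i + delta_mx j i = herm_dir (i, j) + 'i *: herm_dir (j, i).
  by rewrite re im scalerA ii scaleN1r opprB [delta_mx i j + _]addrC addrACA subrr addr0.
by apply: (QD) => //; exact: (QZ).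
Qed.

End MatrixFunctions.

(** Dividing by [h] leaves an error of at most [B * |h|]. A second-order bound of this kind can be
    integrated as a plain inequality, so no limit has to pass through the integral. *)
Lemma derive_quadratic_remainder (K : numFieldType) (V W : normedModType K)
    (G : V -> W) (a v : V) (l : W) (B : K) : 0 <= B ->
  (forall h : K, `|h| <= 1 ->
     `|G (a + h *: v) - G a - h *: l| <= B * `|h| ^+ 2) ->
  'D_v G a = l.
Proof.
move=> B0 Gl; apply: cvg_lim; first exact: norm_hausdorff.
apply/cvgrPdist_le => e e0; near=> h.
have h0 : h != 0 by near: h; exact: nbhs_dnbhs_neq.
have h1 : `|h| <= 1.
  by near: h; apply: dnbhs0_le.
(* The denominator is [B + 1] because [B] may be 0. *)
have he : `|h| <= e / (B + 1).
  by near: h; apply: dnbhs0_le; rewrite divr_gt0// ltr_wpDl.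
rewrite /= distrC.
have -> : h^-1 *: (G (h *: v + a) - G a) - l =
    h^-1 *: (G (a + h *: v) - G a - h *: l).
  by rewrite [RHS]scalerBr scalerA mulVf// scale1r [a + _]addrC.
rewrite normrZ normfV ler_pdivrMl ?normr_gt0// (le_trans (Gl _ h1))//.
rewrite expr2 mulrCA ler_wpM2l//.
rewrite (le_trans (ler_wpM2l B0 he))// mulrCA ler_piMr ?(ltW e0)//.
by rewrite ler_pdivrMr ?mul1r ?lerDl ?ler01// ltr_wpDl.
Unshelve. all: by end_near. Qed.

(** * Second-order remainder of the complex exponential *)

Section ExponentialRemainder.
Context {R : realType}.
Implicit Types x y : R.

Local Lemma MVT_bound0 (f df : R -> R) y B :
  (forall t : R, is_derive t (1 : R) f (df t)) -> f 0 = 0 ->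
  (forall t, `|t| <= `|y| -> `|df t| <= B) -> `|f y| <= B * `|y|.
Proof.
move=> fdf f0 dfB.
have cf : continuous f.
  by move=> t; apply: differentiable_continuous; apply/derivable1_diffP.
have [y0|y0] := leP 0 y.
  have [c] := MVT_segment y0 (fun t _ => fdf t) (continuous_subspaceT cf).
  rewrite in_itv/= f0 !subr0 => /andP[c0 cy] ->.
  by rewrite normrM ler_wpM2r// dfB// !ger0_norm.
have [c] := MVT_segment (ltW y0) (fun t _ => fdf t) (continuous_subspaceT cf).
rewrite in_itv/= f0 !sub0r => /andP[c0 cy] E.
by rewrite -normrN E normrM normrN ler_wpM2r// dfB// !ler0_norm ?lerN2// ltW.
Qed.

Lemma normr_sin_le y : `|sin y| <= `|y|.
Proof.
rewrite -[leRHS]mul1r; apply: (@MVT_bound0 _ cos) => [|t _]; first exact: sin0.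
by rewrite ler_norml cos_geN1 cos_le1.
Qed.

Lemma normr_cosB1_le y : `|cos y - 1| <= `|y| ^+ 2.
Proof.
rewrite expr2; apply: (@MVT_bound0 (fun t => cos t - 1) (fun t => - sin t)).
- by move=> t; apply: is_derive_eq; rewrite subr0.
- by rewrite cos0 subrr.
- by move=> t ty; rewrite normrN (le_trans (normr_sin_le _)).
Qed.

Lemma normr_sinB_le y : `|sin y - y| <= 2 * `|y| ^+ 2.
Proof.
(* A bound linear in [t] and valid for all [t] keeps the remainder of [sin] quadratic globally; for
   large [t] the left side is at most 2. *)
have c1 (t : R) : `|cos t - 1| <= 2 * `|t|.
  have [t1|t1] := leP `|t| 1.
    rewrite (le_trans (normr_cosB1_le _))// expr2 ler_wpM2r//.
    by rewrite (le_trans t1) ?ler1n.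
  rewrite (le_trans (ler_normB _ _))// normr1.
  have : `|cos t| <= 1 by rewrite ler_norml cos_geN1 cos_le1.
  by move: t1; set u := `|t|; set w := `|cos t|; lra.
rewrite expr2 mulrA.
apply: (@MVT_bound0 (fun t => sin t - t) (fun t => cos t - 1)).
- by rewrite sin0 subrr.
- by move=> t ty; rewrite (le_trans (c1 _))// ler_wpM2l.
Qed.

Lemma expR_le_abs x : expR x <= expR `|x|.
Proof. by rewrite ler_expR ler_norm. Qed.

(** Multiplying [1 - x <= expR (- x)] by [expR x] gives [expR x - 1 <= x * expR x], the convexity
    bound behind this estimate and the next. *)
Lemma normr_expRB1_le x : `|expR x - 1| <= `|x| * expR `|x|.
Proof.
have E1 := expR_ge1Dx x; have E2 := expR_ge1Dx (- x).
have ex : 0 < expR x := expR_gt0 x.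
have xx : expR x - 1 <= x * expR x.
  have : expR x * (1 + - x) <= expR x * expR (- x) by rewrite ler_wpM2l// ltW.
  rewrite -expRD subrr expR0; lra.
have ea : 1 <= expR `|x| by rewrite -expR0 ler_expR.
have [x0|x0] := leP 0 x.
  by rewrite !ger0_norm//; lra.
rewrite (ltr0_norm x0) in ea *.
have : expR x <= 1 by rewrite -expR0 ler_expR ltW.
rewrite ler_norml => ex1; apply/andP; split; nra.
Qed.

Lemma normr_expRB1B_le x : `|expR x - 1 - x| <= `|x| ^+ 2 * expR `|x|.
Proof.
have E1 := expR_ge1Dx x; have E2 := expR_ge1Dx (- x).
have xx : expR x - 1 <= x * expR x.
  have : expR x * (1 + - x) <= expR x * expR (- x).
    by rewrite ler_wpM2l// ltW// expR_gt0.
  rewrite -expRD subrr expR0; lra.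
rewrite ger0_norm; last by lra.
rewrite (@le_trans _ _ (x * (expR x - 1)))//; first lra.
rewrite (le_trans (ler_norm _))// normrM expr2 -mulrA ler_wpM2l//.
exact: normr_expRB1_le.
Qed.

(** The real estimates add up to at most [4 * cnorm1 z ^+ 2] times the exponential, and
    [cnorm1 z <= 2 * normc z] turns 4 into 16. *)
Lemma normc_cexpB_le (z : R[i]) :
  Normc.normc (cexp z - 1 - z) <=
  16 * Normc.normc z ^+ 2 * expR `|complex.Re z|.
Proof.
have zn := cnorm1_le_normc z.
have z0 : 0 <= cnorm1 z by rewrite addr_ge0.
rewrite (le_trans (normc_le_cnorm1 _))//.
apply: (@le_trans _ _ (4 * cnorm1 z ^+ 2 * expR `|complex.Re z|)); last first.
  rewrite ler_wpM2r ?expR_ge0//.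
  have : cnorm1 z ^+ 2 <= (2 * Normc.normc z) ^+ 2.
    by rewrite lerXn2r// nnegrE// (le_trans z0).
  by rewrite exprMn; lra.
case: z z0 {zn} => x y; rewrite /cnorm1/= => _.
have e0 : 0 < expR `|x| by exact: expR_gt0.
have -> : expR x * cos y - 1 - x = (expR x - 1 - x) + expR x * (cos y - 1) by ring.
have -> : expR x * sin y - 0 - y = expR x * (sin y - y) + (expR x - 1) * y by ring.
rewrite (le_trans (lerD (ler_normD _ _) (ler_normD _ _)))// !normrM.
rewrite (gtr0_norm (expR_gt0 x)).
have a1 := normr_expRB1B_le x.
have a2 : expR x * `|cos y - 1| <= expR `|x| * `|y| ^+ 2.
  by rewrite ler_pM// ?expR_ge0 ?expR_le_abs ?normr_cosB1_le.
have a3 : expR x * `|sin y - y| <= expR `|x| * (2 * `|y| ^+ 2).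
  by rewrite ler_pM// ?expR_ge0 ?expR_le_abs ?normr_sinB_le.
have a4 : `|expR x - 1| * `|y| <= `|x| * expR `|x| * `|y|.
  by rewrite ler_wpM2r// normr_expRB1_le.
have b1 : 0 <= expR `|x| * `|x| ^+ 2 by rewrite mulr_ge0 ?expR_ge0 ?sqr_ge0.
have b2 : 0 <= expR `|x| * `|y| ^+ 2 by rewrite mulr_ge0 ?expR_ge0 ?sqr_ge0.
have b3 : 0 <= expR `|x| * (`|x| * `|y|) by rewrite !mulr_ge0// expR_ge0.
have -> : 4 * (`|x| + `|y|) ^+ 2 * expR `|x| =
  4 * (expR `|x| * `|x| ^+ 2) + 8 * (expR `|x| * (`|x| * `|y|)) +
  4 * (expR `|x| * `|y| ^+ 2) by ring.
lra.
Qed.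

Lemma expR_norm_le x y : expR (`|x| + `|y|) <=
  expR (x + y) + expR (x - y) + expR (- x + y) + expR (- x - y).
Proof.
have e := @expR_ge0 R.
have := e (x + y); have := e (x - y); have := e (- x + y); have := e (- x - y).
case: (leP 0 x) => [/ger0_norm|/ltr0_norm] ->;
  by case: (leP 0 y) => [/ger0_norm|/ltr0_norm] ->; lra.
Qed.

Lemma normc_cexp (z : R[i]) : Normc.normc (cexp z) = expR (complex.Re z).
Proof.
rewrite /cexp /= !exprMn -mulrDr cos2Dsin2 mulr1 sqrtr_sqr.
by rewrite ger0_norm// expR_ge0.
Qed.

(** The right side is independent of [h], which makes the domination uniform on the unit disc, and
    each of its terms is the modulus of the factor that a shift of the source produces in the
    weight. *)
Lemma expR_Re_le (h w : R[i]) : Normc.normc h <= 1 ->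
  expR `|complex.Re (h * w)| <=
  Normc.normc (cexp ((1 +i* 1) * w)) + Normc.normc (cexp ((1 -i* 1) * w)) +
  Normc.normc (cexp (((-1) +i* 1) * w)) + Normc.normc (cexp (((-1) -i* 1) * w)).
Proof.
move=> h1; apply: (@le_trans _ _ (expR (`|complex.Re w| + `|complex.Im w|))).
  rewrite ler_expR (le_trans (Re_le_normc _))// Normc.normcM.
  rewrite (le_trans _ (normc_le_cnorm1 w))// ler_piMl//.
  by rewrite (le_trans _ (Re_le_normc w)).
rewrite (le_trans (expR_norm_le _ _))// !normc_cexp !ReM/=.
rewrite !(mul1r, mulN1r, opprK).
have e := @expR_ge0 R; rewrite le_eqVlt; apply/orP; left; apply/eqP; ring.
Qed.

End ExponentialRemainder.

(** * Moments of the weight and their derivatives in the source *)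

Section Moments.
Context {R : realType} {L : nat}.
Local Notation C := R[i].
Local Notation M := 'M[C]_L.
Local Notation K := ('I_L * 'I_L)%type.
Local Notation normc := Normc.normc.
Local Notation origin := (fun=> 0 : R).
Local Notation coords := (enum {: K}).

Definition source (J phi : M) : C := \sum_a \sum_b J a b * phi a b.

Context (W : M -> C).

Definition weight (J phi : M) : C := cexp (W phi + source J phi).

Definition moment (P : M -> C) (J : M) : C :=
  herm_int (fun phi => P phi * weight J phi).

Hypothesis polyW : polyfun W.
Hypothesis integrable_monomials : forall (J : M) (s : seq K),
  herm_abs_integrable (fun phi => (\prod_(p <- s) phi p.1 p.2) * weight J phi).

Local Notation hintegrable G := (cintegrable coords (fun x => G (herm x)) origin).

Lemma polyfun_source J : polyfun (source J).
Proof.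
apply: polyfun_sum => a; apply: polyfun_sum => b.
by apply: polyfunZ; exact: polyfun_entry.
Qed.

Lemma cmeasurable_weight P J : polyfun P ->
  cmeasurable (fun x : g_sigma_algebraType (@cylinders R K) =>
    P (herm (x : K -> R)) * weight J (herm (x : K -> R))).
Proof.
move=> pP; apply: cmeasurableM; first exact: cmeasurable_polyfun.
apply: cmeasurable_cexp.
have pQ := polyfunD polyW (polyfun_source J).
exact: (cmeasurable_polyfun pQ).
Qed.

Lemma polyfun_prod (s : seq K) : polyfun (fun phi : M => \prod_(p <- s) phi p.1 p.2).
Proof.
elim: s => [|p s IH].
  by under eq_fun do rewrite big_nil; exact: polyfun_cst.
under eq_fun do rewrite big_cons.
by apply: polyfunM => //; exact: polyfun_entry.
Qed.

(* Integrability against all monomials is preserved by multiplication with a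
   polynomial; this is the form of the claim that survives induction. *)
Lemma hintegrable_weight P J : polyfun P ->
  hintegrable (fun phi : M => P phi * weight J phi).
Proof.
move=> pP.
suff gen : forall G : M -> C,
    (forall s : seq K,
      hintegrable (fun phi : M => (\prod_(p <- s) phi p.1 p.2) * G phi)) ->
    forall s : seq K,
      hintegrable (fun phi : M => (\prod_(p <- s) phi p.1 p.2) * (P phi * G phi)).
  have mono (s : seq K) :
      hintegrable (fun phi : M => (\prod_(p <- s) phi p.1 p.2) * weight J phi).
    apply: cintegrable_normc; last exact: integrable_monomials.
    exact: (cmeasurable_weight J (polyfun_prod s)).
  have := gen (weight J) mono [::].
  by under eq_fun do rewrite big_nil mul1r.
elim: pP => [c|i j|{}P Q _ IHP _ IHQ|{}P Q _ IHP _ IHQ] G GP s.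
- by under eq_fun do rewrite mulrCA; exact: (cintegrableZ c (GP s)).
- under eq_fun do rewrite mulrA [_ * herm _ i j]mulrC.
  have := GP ((i, j) :: s).
  by under eq_fun do rewrite big_cons.
- under eq_fun do rewrite mulrDl mulrDr.
  exact: (cintegrableD (IHP G GP s) (IHQ G GP s)).
- under eq_fun do rewrite -mulrA.
  exact: (IHP (fun phi => Q phi * G phi) (IHQ G GP) s).
Qed.

Lemma momentD P Q J : polyfun P -> polyfun Q ->
  moment (fun phi => P phi + Q phi) J = moment P J + moment Q J.
Proof.
move=> pP pQ; rewrite /moment /herm_int.
under eq_fun do rewrite mulrDl.
exact: (iterintD (hintegrable_weight J pP) (hintegrable_weight J pQ)).
Qed.

Lemma momentZ c P J : polyfun P -> moment (fun phi => c * P phi) J = c * moment P J.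
Proof.
move=> pP; rewrite /moment /herm_int.
under eq_fun do rewrite -mulrA.
exact: (iterintZ c (hintegrable_weight J pP)).
Qed.

Lemma momentB P Q J : polyfun P -> polyfun Q ->
  moment (fun phi => P phi - Q phi) J = moment P J - moment Q J.
Proof.
move=> pP pQ; under [in LHS]eq_fun do rewrite -mulN1r.
rewrite momentD//; last exact: polyfunZ.
by rewrite momentZ// mulN1r.
Qed.

Lemma moment_sum (I : Type) (s : seq I) (P : I -> M -> C) J :
  (forall i, polyfun (P i)) ->
  moment (fun phi => \sum_(i <- s) P i phi) J = \sum_(i <- s) moment (P i) J.
Proof.
move=> pP; elim: s => [|i s IH].
  rewrite big_nil -[RHS](mul0r (moment (fun=> 0) J)) -momentZ; last exact: polyfun_cst.
  by congr moment; apply/funext => phi; rewrite big_nil mul0r.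
rewrite big_cons -IH -momentD//; last exact: polyfun_sum.
by congr moment; apply/funext => phi; rewrite big_cons.
Qed.

Lemma source_delta J h i j phi :
  source (J + h *: delta_mx i j) phi = source J phi + h * phi i j.
Proof.
rewrite /source; under eq_bigr do under eq_bigr do rewrite !mxE mulrDl.
under eq_bigr do rewrite big_split /=.
rewrite big_split /=; congr (_ + _).
rewrite (bigD1 i)//= (bigD1 j)//= !eqxx mulr1 !big1 ?addr0//.
- by move=> a /negbTE ai; rewrite big1// => b _; rewrite ai mulr0 mul0r.
- by move=> b /negbTE bj; rewrite bj andbF mulr0 mul0r.
Qed.

Lemma weight_delta J h i j phi :
  weight (J + h *: delta_mx i j) phi = weight J phi * cexp (h * phi i j).
Proof. by rewrite /weight source_delta addrA (cexpD _ (h * phi i j)). Qed.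

Lemma derive_moment P J i j : polyfun P ->
  'D_(delta_mx i j) (moment P) J = moment (fun phi => P phi * phi i j) J.
Proof.
move=> pP.
have pe : polyfun (fun phi : M => phi i j) by exact: polyfun_entry.
pose G (c : C) phi := (P phi * (phi i j * phi i j)) *
  weight (J + c *: delta_mx i j) phi.
have Gi c : hintegrable (G c).
  exact: (hintegrable_weight _ (polyfunM pP (polyfunM pe pe))).
(* The constant is [2 * 16]: 2 from [cnorm1_le_normc] and 16 from [normc_cexpB_le]. The square of
   [phi i j] inside [G] comes from the quadratic remainder. *)
pose b phi := 32 * (cnorm1 (G (1 +i* 1) phi) + cnorm1 (G (1 -i* 1) phi) +
  cnorm1 (G ((-1) +i* 1) phi) + cnorm1 (G ((-1) -i* 1) phi)).
have bi : absolutely_integrable coords (fun x => b (herm x)) origin.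
  have cn c := cintegrable_cnorm1 (Gi c).
  exact: (absolutely_integrableZ 32 (absolutely_integrableD (absolutely_integrableD
    (absolutely_integrableD (cn (1 +i* 1)) (cn (1 -i* 1))) (cn ((-1) +i* 1)))
    (cn ((-1) -i* 1)))).
(* Integrand of the increment minus its linear part; it factors as [P phi * weight J phi] times the
   second-order remainder of [cexp] at [h * phi i j]. *)
pose rem h phi := P phi * weight (J + h *: delta_mx i j) phi
  - P phi * weight J phi - h * (P phi * phi i j * weight J phi).
have remb h phi : normc h <= 1 -> cnorm1 (rem h phi) <= normc h ^+ 2 * b phi.
  move=> h1.
  have -> : rem h phi = P phi * weight J phi *
      (cexp (h * phi i j) - 1 - h * phi i j).
    by rewrite /rem weight_delta; ring.
  rewrite (le_trans (cnorm1_le_normc _))// Normc.normcM.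
  have n0 (z : C) : 0 <= normc z by rewrite (le_trans _ (Re_le_normc z)).
  apply: (@le_trans _ _ (2 * (normc (P phi * weight J phi) *
    (16 * normc (h * phi i j) ^+ 2 * expR `|complex.Re (h * phi i j)|)))).
    by rewrite ler_wpM2l// ler_wpM2l// normc_cexpB_le.
  have nG c : normc (P phi * weight J phi) * normc (phi i j) ^+ 2 *
      normc (cexp (c * phi i j)) <= cnorm1 (G c phi).
    rewrite (le_trans _ (normc_le_cnorm1 _))// /G weight_delta.
    rewrite !Normc.normcM le_eqVlt; apply/orP; left; apply/eqP; ring.
  rewrite Normc.normcM exprMn.
  set A := normc (P phi * weight J phi) in nG *.
  set w := normc (phi i j) in nG *.
  have Aw : 0 <= A * w ^+ 2 by rewrite mulr_ge0 ?sqr_ge0 ?n0.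
  apply: (@le_trans _ _ (normc h ^+ 2 * (32 * (A * w ^+ 2 *
    expR `|complex.Re (h * phi i j)|)))).
    by rewrite le_eqVlt; apply/orP; left; apply/eqP; ring.
  rewrite ler_wpM2l ?sqr_ge0// /b ler_wpM2l//.
  rewrite (le_trans (ler_wpM2l Aw (expR_Re_le _ h1)))// !mulrDr.
  by rewrite !lerD.
have remi h : hintegrable (rem h).
  apply: cintegrableD; first apply: cintegrableD.
  - exact: hintegrable_weight.
  - under eq_fun do rewrite -mulN1r; apply: cintegrableZ.
    exact: hintegrable_weight.
  - under eq_fun do rewrite -mulNr; apply: cintegrableZ.
    exact: (hintegrable_weight J (polyfunM pP pe)).
pose B := 2 * riter coords (fun x => b (herm x)) origin.
have B0 : 0 <= B.
  rewrite mulr_ge0//; apply: riter_ge0 => x.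
  by rewrite mulr_ge0// !addr_ge0.
apply: (@derive_quadratic_remainder _ _ _ _ _ _ _ B%:C); first by rewrite lecR.
move=> h; rewrite -[`|h|]/((normc h)%:C) -[1]/((1 : R)%:C) lecR => h1.
rewrite (_ : _ - _ - _ = herm_int (rem h)).
  rewrite -[`|herm_int _|]/((normc (herm_int (rem h)))%:C) -rmorphXn -rmorphM lecR.
  apply: le_trans (normc_iterint_le (remi h)
    (absolutely_integrableZ (normc h ^+ 2) bi) (fun x => remb h (herm x) h1)) _.
  by rewrite riterZ// /B mulrCA mulrC.
rewrite /moment -[h *: herm_int _]/(h * herm_int _) /herm_int /rem.
have i1 := hintegrable_weight (J + h *: delta_mx i j) pP.
have i2 := hintegrable_weight J pP.
have i3 := hintegrable_weight J (polyfunM pP pe).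
under [in RHS]eq_fun do rewrite -mulN1r -mulNr.
have i2' := cintegrableZ (-1) i2.
have i3' := cintegrableZ (- h) i3.
rewrite (iterintD (cintegrableD i1 i2') i3') (iterintD i1 i2') (iterintZ _ i2).
by rewrite (iterintZ _ i3) mulN1r mulNr.
Qed.

End Moments.

(** * Integrals of total derivatives in matrix-unit directions *)

Section WardIdentity.
Context {R : realType} {L : nat}.
Local Notation C := R[i].
Local Notation M := 'M[C]_L.
Local Notation K := ('I_L * 'I_L)%type.
Local Notation origin := (fun=> 0 : R).
Local Notation coords := (enum {: K}).

(** [dW phi H] stands for the derivative of [W] at [phi] along [H]; the complex linearity in [H]
    assumed below gives it a meaning for non-Hermitian [H]. *)
Context (W : M -> C) (dW : M -> M -> C).
Hypothesis polyW : polyfun W.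
Hypothesis integrable_monomials : forall (J : M) (s : seq K),
  herm_abs_integrable (fun phi => (\prod_(p <- s) phi p.1 p.2) * weight W J phi).
Hypothesis dWP : forall (phi : R -> M) (H : M), mxderive phi (fun=> H) ->
  cderive (fun t => W (phi t)) (fun t => dW (phi t) H).
Hypothesis dWZ : forall phi c H, dW phi (c *: H) = c * dW phi H.
Hypothesis dWD : forall phi H1 H2, dW phi (H1 + H2) = dW phi H1 + dW phi H2.
Hypothesis poly_dW : forall H, polyfun (fun phi => dW phi H).

Lemma sourceZ (J : M) (c : C) (H : M) : source J (c *: H) = c * source J H.
Proof.
rewrite /source mulr_sumr; apply: eq_bigr => a _; rewrite mulr_sumr.
by apply: eq_bigr => b _; rewrite mxE mulrCA.
Qed.

Lemma sourceD (J H1 H2 : M) : source J (H1 + H2) = source J H1 + source J H2.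
Proof.
rewrite /source -big_split; apply: eq_bigr => a _; rewrite -big_split.
by apply: eq_bigr => b _; rewrite mxE mulrDr.
Qed.

Lemma cderive_source (J : M) (phi dphi : R -> M) : mxderive phi dphi ->
  cderive (fun t => source J (phi t)) (fun t => source J (dphi t)).
Proof.
move=> dphiP; apply: cderive_sum => a; apply: cderive_sum => b.
by apply: cderiveZ; exact: dphiP.
Qed.

Lemma source_delta_mx (J : M) a b : source J (delta_mx a b) = J a b.
Proof.
have := source_delta 0 1 a b J; rewrite scale1r add0r mul1r.
rewrite {2}/source big1 ?add0r => [|i _]; last by rewrite big1// => j _; rewrite mxE mul0r.
move=> <-; rewrite /source; apply: eq_bigr => i _; apply: eq_bigr => j _.
by rewrite mulrC.
Qed.

Local Notation dlog J H phi := (dW phi H + source J H).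

Lemma polyfun_dlog (J H : M) i j : polyfun (fun phi : M => H i j + phi i j * dlog J H phi).
Proof.
apply: polyfunD; first exact: polyfun_cst.
apply: polyfunM; first exact: polyfun_entry.
apply: polyfunD => //; exact: polyfun_cst.
Qed.

(** The inserted polynomial is the derivative of [phi i j * weight] along [H], divided by the
    weight. For a coordinate direction this is a genuine partial derivative, and the expression is
    linear in [H]. *)
Lemma moment_total_derivative (J H : M) i j :
  (exists a b, H = delta_mx a b) ->
  moment W (fun phi => H i j + phi i j * dlog J H phi) J = 0.
Proof.
move=> [a [b ->]]; move: a b.
apply: (@delta_mx_herm_ind _ _ (fun H =>
  moment W (fun phi => H i j + phi i j * dlog J H phi) J = 0)).
- move=> k; have pdl := polyfun_dlog J (herm_dir k) i j.
  have pe : polyfun (fun phi : M => phi i j) by exact: polyfun_entry.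
  have pQ := polyfunD polyW (polyfun_source J).
  apply: (iterint_partial_derivative (k := k) (enum_uniq _) _ _ _
    (hintegrable_weight polyW integrable_monomials J pe)
    (hintegrable_weight polyW integrable_monomials J pdl)).
  + by rewrite mem_enum.
  + move=> x; have dh := mxderive_herm x k.
    apply: eq_cderive (cderiveM (dh i j)
      (cderive_cexp (cderiveD (dWP dh) (cderive_source J dh)))) => // t.
    by rewrite mulrDl mulrA.
  + move=> x; have dh := mxderive_herm x k.
    have [dP dPP] := cderive_polyfun pdl dh.
    have [dQ dQP] := cderive_polyfun pQ dh.
    exact: cderive_ccontinuous (cderiveM dPP (cderive_cexp dQP)).
- move=> c A A0; rewrite -[RHS](mulr0 c) -A0 -(momentZ polyW)//; last exact: polyfun_dlog.
  congr moment; apply/funext => phi; rewrite dWZ sourceZ mxE; ring.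
- move=> A B A0 B0; rewrite -[RHS]addr0 -{1}A0 -B0 -(momentD polyW)//; try exact: polyfun_dlog.
  congr moment; apply/funext => phi; rewrite dWD sourceD mxE; ring.
Qed.

End WardIdentity.

(** * Derivatives of the trace action and of the regulator *)

Section Action.
Context {R : realType} {L : nat} (g : seq R) (r : 'I_L -> 'I_L -> 'I_L -> 'I_L -> R[i]).
Local Notation C := R[i].
Local Notation M := 'M[C]_L.

Definition action (phi : M) : C := \sum_(k < size g) (g`_k)%:C * \tr (phi ^+ k).
Definition regulator (phi : M) : C :=
  2^-1 * \sum_a \sum_b \sum_c \sum_d phi a b * r a b c d * phi c d.

(** At [k = 0], where [k.-1] is 0, the factor [k%:R] kills the term, as the derivative of a constant
    requires. *)
Definition daction (phi H : M) : C :=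
  \sum_(k < size g) (g`_k)%:C * (k%:R * \tr (H * phi ^+ k.-1)).
Definition dregulator (phi H : M) : C :=
  2^-1 * \sum_a \sum_b \sum_c \sum_d
    (H a b * r a b c d * phi c d + phi a b * r a b c d * H c d).

Local Notation W := (fun phi => - action phi - regulator phi).
Local Notation dW := (fun phi H => - daction phi H - dregulator phi H).

Lemma polyfun_action : polyfun W.
Proof.
apply: polyfunD; apply: polyfunN.
  apply: polyfun_sum => k; apply: polyfunZ.
  exact: (polyfun_tr (polymx_exp k)).
apply: polyfunZ; apply: polyfun_sum => a; apply: polyfun_sum => b.
apply: polyfun_sum => c; apply: polyfun_sum => d.
apply: polyfunM; last exact: polyfun_entry.
apply: polyfunM; [exact: polyfun_entry|exact: polyfun_cst].
Qed.

Lemma polyfun_daction H : polyfun (fun phi => dW phi H).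
Proof.
apply: polyfunD; apply: polyfunN.
  apply: polyfun_sum => k; do 2!apply: polyfunZ.
  apply: (polyfun_tr (A := fun phi => H *m phi ^+ k.-1)).
  apply: polymx_mul; last exact: polymx_exp.
  by move=> i j; exact: polyfun_cst.
apply: polyfunZ; apply: polyfun_sum => a; apply: polyfun_sum => b.
apply: polyfun_sum => c; apply: polyfun_sum => d.
apply: polyfunD; apply: polyfunM; try exact: polyfun_entry; try exact: polyfun_cst.
apply: polyfunM; [exact: polyfun_entry|exact: polyfun_cst].
Qed.

Lemma cderive_action (phi : R -> M) H : mxderive phi (fun=> H) ->
  cderive (fun t => W (phi t)) (fun t => dW (phi t) H).
Proof.
move=> dphi.
have d1 : cderive (fun t => action (phi t)) (fun t => daction (phi t) H).
  apply: cderive_sum => k; apply: cderiveZ.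
  apply: eq_cderive (mxderive_tr (mxderive_exp k dphi)) => // t.
  by rewrite mxtrace_dexp.
have d2 : cderive (fun t => regulator (phi t)) (fun t => dregulator (phi t) H).
  apply: cderiveZ; do 2!apply: cderive_sum => ?.
  apply: cderive_sum => c; apply: cderive_sum => d.
  apply: eq_cderive (cderiveM (cderiveM (dphi _ _) (cderive_cst (r _ _ c d))) (dphi c d)) => // t.
  by rewrite mulr0 addr0.
have := cderiveD (cderiveZ (-1) d1) (cderiveZ (-1) d2).
by apply: eq_cderive => t; rewrite !mulN1r.
Qed.

Lemma dactionZ phi c (H : M) : dW phi (c *: H) = c * dW phi H.
Proof.
rewrite /daction /dregulator mulrBr mulrN; congr (- _ - _).
  rewrite mulr_sumr; apply: eq_bigr => k _.
  by rewrite -[(c *: H) * _]/((c *: H) *m _) -scalemxAl mxtraceZ !(mulrCA c).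
rewrite mulrCA; congr (_ * _); rewrite mulr_sumr; apply: eq_bigr => a _.
rewrite mulr_sumr; apply: eq_bigr => b _; rewrite mulr_sumr; apply: eq_bigr => e _.
rewrite mulr_sumr; apply: eq_bigr => d _; rewrite !mxE; ring.
Qed.

Lemma dactionD phi (H1 H2 : M) : dW phi (H1 + H2) = dW phi H1 + dW phi H2.
Proof.
have -> : daction phi (H1 + H2) = daction phi H1 + daction phi H2.
  rewrite /daction -big_split; apply: eq_bigr => k _ /=.
  by rewrite mulrDl linearD /= !mulrDr.
have -> : dregulator phi (H1 + H2) = dregulator phi H1 + dregulator phi H2.
  rewrite /dregulator -mulrDr; congr (_ * _).
  rewrite -big_split; apply: eq_bigr => a _; rewrite -big_split; apply: eq_bigr => b _.
  rewrite -big_split; apply: eq_bigr => e _; rewrite -big_split; apply: eq_bigr => d _.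
  rewrite !mxE /=; ring.
ring.
Qed.

Lemma mxtrace_delta_mul (A : M) i j : \tr (delta_mx i j * A) = A j i.
Proof.
rewrite /mxtrace (bigD1 i)//= mxE (bigD1 j)//= !mxE !eqxx mul1r.
rewrite !big1 ?addr0// => [k /negbTE ki|k /negbTE kj].
  by rewrite mxE big1// => l _; rewrite mxE ki mul0r.
by rewrite mxE kj andbF mul0r.
Qed.

(* The action is invariant under conjugation, hence annihilated by the vector
   field [phi |-> [delta_mx a c, phi]]. *)
Lemma daction_commutator (phi : M) a c :
  \sum_b (phi c b * daction phi (delta_mx a b) -
          phi b a * daction phi (delta_mx b c)) = 0.
Proof.
rewrite sumrB; apply/eqP; rewrite subr_eq0; apply/eqP.
(* The first sum yields [phi * phi ^+ k.-1] and the second [phi ^+ k.-1 * phi]; this form of the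
   middle term treats [k = 0] uniformly. *)
transitivity (\sum_(k < size g) (g`_k)%:C * (k%:R * (phi * phi ^+ k.-1) c a)).
  under eq_bigr do rewrite /daction mulr_sumr.
  rewrite exchange_big; apply: eq_bigr => k _.
  rewrite mxE !mulr_sumr; apply: eq_bigr => b _.
  rewrite mxtrace_delta_mul; ring.
under [in RHS]eq_bigr do rewrite /daction mulr_sumr.
rewrite [in RHS]exchange_big; apply: eq_bigr => k _.
rewrite -exprS exprSr mxE !mulr_sumr; apply: eq_bigr => b _.
rewrite mxtrace_delta_mul; ring.
Qed.

(** The symmetry of [r] makes the two terms of the product rule equal, and their sum cancels the
    factor one half. *)
Lemma dregulator_delta (phi : M) i j : (forall a b c d, r a b c d = r c d a b) ->
  dregulator phi (delta_mx i j) = \sum_d \sum_e r i j d e * phi d e.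
Proof.
move=> hr; rewrite /dregulator.
have pick (F : 'I_L -> 'I_L -> C) :
    \sum_a \sum_b (delta_mx i j : M) a b * F a b = F i j.
  rewrite (bigD1 i)//= (bigD1 j)//= mxE !eqxx mul1r !big1 ?addr0//.
  - by move=> a /negbTE ai; rewrite big1// => b _; rewrite mxE ai mul0r.
  - by move=> b /negbTE bj; rewrite mxE bj andbF mul0r.
transitivity (2^-1 * (\sum_a \sum_b (delta_mx i j : M) a b *
    (\sum_c \sum_d r a b c d * phi c d) +
  \sum_a \sum_b phi a b * (\sum_c \sum_d (delta_mx i j : M) c d * r a b c d))).
  congr (_ * _); rewrite -big_split; apply: eq_bigr => a _.
  rewrite -big_split; apply: eq_bigr => b _ /=.
  rewrite !mulr_sumr -big_split; apply: eq_bigr => c _ /=.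
  rewrite !mulr_sumr -big_split; apply: eq_bigr => d _ /=; ring.
rewrite pick; under [X in _ + X]eq_bigr do under eq_bigr do rewrite pick hr mulrC.
set T := (X in _ = X).
by rewrite -[T + T]mulr2n -[T *+ 2]mulr_natl mulKf// pnatr_eq0.
Qed.

End Action.

Unset Implicit Arguments.

Theorem theorem1 (R : realType) (L : nat) (hL : (1 <= L)%N)
    (g : seq R) (r : 'I_L -> 'I_L -> 'I_L -> 'I_L -> R[i])
    (hr : forall a b c d, r a b c d = r c d a b) :
  let S : 'M[R[i]]_L -> R[i] :=
    fun phi => \sum_(k < size g) (g`_k)%:C * \tr (phi ^+ k) in
  let DS : 'M[R[i]]_L -> R[i] :=
    fun phi => 2^-1 * \sum_a \sum_b \sum_c \sum_d phi a b * r a b c d * phi c d in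
  let Jdot : 'M[R[i]]_L -> 'M[R[i]]_L -> R[i] :=
    fun J phi => \sum_a \sum_b J a b * phi a b in
  let integrand : 'M[R[i]]_L -> 'M[R[i]]_L -> R[i] :=
    fun J phi => cexp (- S phi - DS phi + Jdot J phi) in
  let Z : 'M[R[i]]_L -> R[i] := fun J => herm_int (integrand J) in
  let D : 'I_L -> 'I_L -> ('M[R[i]]_L -> R[i]) -> 'M[R[i]]_L -> R[i] :=
    fun a b F J => 'D_(delta_mx a b) F J in
  (forall (J : 'M[R[i]]_L) (s : seq ('I_L * 'I_L)),
      herm_abs_integrable
        (fun phi => (\prod_(p <- s) phi p.1 p.2) * integrand J phi)) ->
  forall (a c : 'I_L) (J : 'M[R[i]]_L),
    \sum_b \sum_d \sum_e
        D d e (fun J' => r a b d e * D c b Z J' - r b c d e * D b a Z J') J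
    - \sum_b (J a b * D c b Z J - J b c * D b a Z J) = 0.
Proof.
move=> S DS Jdot integrand Z D hint a c J.
pose W phi := - action g phi - regulator r phi.
pose dW phi H := - daction g phi H - dregulator r phi H.
have pW : polyfun W := polyfun_action g r.
have pe i j : polyfun (fun phi : 'M[R[i]]_L => phi i j) by exact: polyfun_entry.
have hint' : forall (J : 'M[R[i]]_L) (s : seq ('I_L * 'I_L)),
    herm_abs_integrable (fun phi => (\prod_(p <- s) phi p.1 p.2) * weight W J phi).
  exact: hint.
have ZE : Z = moment W (fun=> 1).
  apply/funext => J'; rewrite /moment; congr herm_int.
  by apply/funext => phi; rewrite mul1r.
have DZ i j J' : D i j Z J' = moment W (fun phi => phi i j) J'.
  rewrite /D ZE (derive_moment pW hint')//; last exact: polyfun_cst.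
  by congr moment; apply/funext => phi; rewrite mul1r.
have pE b d e : polyfun (fun phi : 'M[R[i]]_L =>
    (r a b d e * phi c b - r b c d e * phi b a) * phi d e).
  apply: polyfunM => //; apply: polyfunD; last apply: polyfunN;
    by apply: polyfunZ.
have DDZ b d e : D d e (fun J' => r a b d e * D c b Z J' - r b c d e * D b a Z J') J
    = moment W (fun phi => (r a b d e * phi c b - r b c d e * phi b a) * phi d e) J.
  have p2 : polyfun (fun phi : 'M[R[i]]_L => r a b d e * phi c b - r b c d e * phi b a).
    by apply: polyfunD; last apply: polyfunN; apply: polyfunZ.
  rewrite -(derive_moment pW hint' J d e p2) /D; congr derive.
  apply/funext => J'; rewrite -!/(D _ _ _ _) !DZ.
  by rewrite (momentB pW hint')//; try exact: polyfunZ; rewrite !(momentZ pW hint').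
(* [X b] and [Y b] are, relative to the weight, the derivatives of [phi c b * weight] along
   [delta_mx a b] and of [phi b a * weight] along [delta_mx b c]. *)
pose X (b : 'I_L) (phi : 'M[R[i]]_L) := (delta_mx a b : 'M[R[i]]_L) c b
  + phi c b * (dW phi (delta_mx a b) + source J (delta_mx a b)).
pose Y (b : 'I_L) (phi : 'M[R[i]]_L) := (delta_mx b c : 'M[R[i]]_L) b a
  + phi b a * (dW phi (delta_mx b c) + source J (delta_mx b c)).
have pdW H : polyfun (fun phi => dW phi H) := polyfun_daction g r H.
have pX b : polyfun (X b) := polyfun_dlog pdW J (delta_mx a b) c b.
have pY b : polyfun (Y b) := polyfun_dlog pdW J (delta_mx b c) b a.
have ward H i j : (exists a b, H = delta_mx a b) ->
    moment W (fun phi => H i j + phi i j * (dW phi H + source J H)) J = 0.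
  apply: (moment_total_derivative pW hint') => //.
  - by move=> phi H'; exact: cderive_action.
  - by move=> phi c' H'; exact: dactionZ.
  - by move=> phi H1 H2; exact: dactionD.
have X0 b : moment W (X b) J = 0 by apply: ward; exists a, b.
have Y0 b : moment W (Y b) J = 0 by apply: ward; exists b, c.
under eq_bigr do under eq_bigr do under eq_bigr do rewrite DDZ.
under [X in _ - X]eq_bigr do rewrite !DZ.
pose T (b : 'I_L) (phi : 'M[R[i]]_L) := \sum_d \sum_e ((r a b d e * phi c b - r b c d e * phi b a) * phi d e)
  - (J a b * phi c b - J b c * phi b a).
have pT1 b : polyfun (fun phi : 'M[R[i]]_L => \sum_d \sum_e
   ((r a b d e * phi c b - r b c d e * phi b a) * phi d e)).
  by apply: polyfun_sum => d; exact: polyfun_sum.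
have pT2 b : polyfun (fun phi : 'M[R[i]]_L => J a b * phi c b - J b c * phi b a).
  by apply: polyfunD; last apply: polyfunN; apply: polyfunZ.
transitivity (moment W (fun phi => \sum_b T b phi) J).
  rewrite (moment_sum pW hint'); last first.
    by move=> b; apply: polyfunD => //; exact: polyfunN.
  rewrite -sumrB; apply: eq_bigr => b _.
  rewrite (momentB pW hint')// (moment_sum pW hint'); last first.
    by move=> d; exact: polyfun_sum.
  congr (_ - _).
    by apply: eq_bigr => d _; rewrite (moment_sum pW hint').
  rewrite (momentB pW hint')//; try exact: polyfunZ.
  by rewrite !(momentZ pW hint').
(* The order [Y - X] reflects the minus sign of the regulator in the exponent. The two integrands
   agree only after summation over [b], since their difference is the variation of the action. *)
transitivity (moment W (fun phi => \sum_b (Y b phi - X b phi)) J); last first.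
  rewrite (moment_sum pW hint'); last first.
    by move=> b; apply: polyfunD => //; exact: polyfunN.
  by rewrite big1// => b _; rewrite (momentB pW hint')// X0 Y0 subrr.
congr moment; apply/funext => phi.
apply/eqP; rewrite -subr_eq0 -sumrB; apply/eqP.
transitivity (- \sum_b (phi c b * daction g phi (delta_mx a b) -
    phi b a * daction g phi (delta_mx b c))); last first.
  by rewrite daction_commutator oppr0.
rewrite -sumrN; apply: eq_bigr => b _.
rewrite /T /X /Y /dW !source_delta_mx !(dregulator_delta _ _ _ hr) !mxE !eqxx/= !andbT.
(* The constant terms of [X b] and [Y b] are both the indicator of [a = c] and now cancel: the
   vector field is divergence free. *)
rewrite [c == a]eq_sym.
under eq_bigr do (under eq_bigr do rewrite mulrBl ![_ * phi c b]mulrC ![_ * phi b a]mulrC -!mulrA; rewrite sumrB -!mulr_sumr).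
rewrite sumrB -!mulr_sumr; ring.
Qed.
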